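(* Let $\Lambda=K\Gamma/I$ be a triangular left multiserial algebra with Jacobson radical $J$, and let $U$ be a uniserial left $\Lambda$-module with mast $p=\alpha_{n-1}\cdots\alpha_1$, where $\alpha_i\colon i\to i+1$. Then the following statements are equivalent: (1) The embedding $JU\hookrightarrow U$ is irreducible. (2) $U$ is not simple and satisfies both (a) and (b) below: (a) For every $\beta\in B$, $\ \beta\alpha_{\mathrm{s}(\beta)-1}\cdots\alpha_1\in Jp$, and for every $\delta\in D$, $\ \delta\alpha_{\mathrm{s}(\delta)-1}\cdots\alpha_1\in K\,\alpha_{\mathrm{t}(\delta)-1}\cdots\alpha_1$. (b) There exists a subset $R\subset J$ such that $\{rp+J^2p\mid r\in R\}$ forms a $K$-basis for $Jp/J^2p$ and (i) and (ii) both hold: (i) for every $\gamma\in C$ there exists $w\in pJ$ such that, for every $r\in R$, $\ r\alpha_{n-1}\cdots\alpha_{\mathrm{t}(\gamma)}\gamma=rw$; (ii) for every $\delta\in D$ and every $r\in R$, $\ r\alpha_{n-1}\cdots\alpha_{\mathrm{t}(\delta)}\delta\in K\,r\alpha_{n-1}\cdots\alpha_{\mathrm{s}(\delta)}$.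
   Context: $K$ is a field, $\Gamma$ a finite quiver with vertex set $\Gamma_0$ and arrow set $\Gamma_1$, $I$ an admissible ideal of the path algebra $K\Gamma$, and $\Lambda=K\Gamma/I$ is finite-dimensional; modules are finitely generated left modules. Paths and maps are composed from right to left; $\mathrm{s}(q)$ and $\mathrm{t}(q)$ are the starting and end points of a path $q$. Vertices and paths are identified with their classes in $\Lambda$ where useful. $\Lambda$ is triangular if $\Gamma$ has no directed cycles. A module is uniserial if it has only one composition series with simple factors. $\Lambda$ is left multiserial if, for each primitive idempotent $e$ of $\Lambda$, the left ideal $Je$ is a sum of uniserial $\Lambda$-modules. If $U$ is uniserial of length $n$, a mast of $U$ is a path $p$ in $\Gamma$ of length $n-1$ such that $px\neq0$ for some $x\in U$. The vertices passed by $p$ are named $1,\dots,n$, so $p=1\xrightarrow{\alpha_1}2\xrightarrow{\alpha_2}\cdots\xrightarrow{\alpha_{n-1}}n$. An expression $\alpha_i\cdots\alpha_j$ with $i<j$ stands for $1$. Define $B=\{\beta\in\Gamma_1\mid \mathrm{s}(\beta)\in\{1,\dots,n-1\},\ \mathrm{t}(\beta)\notin\{1,\dots,n\}\}$, $C=\{\gamma\in\Gamma_1\mid \mathrm{s}(\gamma)\notin\{1,\dots,n\},\ \mathrm{t}(\gamma)\in\{2,\dots,n\}\}$, $D=\{\delta\in\Gamma_1\mid \{\mathrm{s}(\delta),\mathrm{t}(\delta)\}\subset\{1,\dots,n\},\ \delta\notin\{\alpha_1,\dots,\alpha_{n-1}\}\}$. A map $f$ of finitely generated modules is irreducible if it is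 neither a split monomorphism nor a split epimorphism and $f=gh$ implies that $h$ is a split monomorphism or $g$ is a split epimorphism. *)

(* Defs.v *)
(* Mathematical Components; classical sets come from the classical layer of
   MathComp-Analysis, {malg K[T]} (finitely supported functions from T to K)
   from multinomials. *)
From HB Require Import structures.
From mathcomp Require Import all_boot all_algebra.
From mathcomp Require Import finmap monalg.
From mathcomp Require Import boolp classical_sets.

Set Implicit Arguments.
Unset Strict Implicit.
Unset Printing Implicit Defensive.

Import GRing.Theory.
Local Open Scope ring_scope.
Local Open Scope classical_set_scope.

(* Without a vertex the path algebra would be the zero ring. *)
Record quiver := Quiver {
  vertex : finType;
  arrow : finType;
  src : arrow -> vertex;
  tgt : arrow -> vertex;
  quiver_nonempty : (0 < #|vertex|)%N
}.

Section Paths.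
Variable Q : quiver.
Implicit Types (v : vertex Q) (a : arrow Q) (s : seq (arrow Q)).

(* Arrows are listed in the order in which they are passed: the sequence
   [:: a_1; ..; a_m] stands for the composite a_m ... a_1. *)
Fixpoint is_walk v s : bool :=
  if s is a :: s' then (src a == v) && is_walk (tgt a) s' else true.

Definition walk_end v s : vertex Q := last v [seq tgt a | a <- s].

(* Starting point and list of arrows; (v, [::]) is the trivial path at v. *)
Definition qpath : Type := {x : vertex Q * seq (arrow Q) | is_walk x.1 x.2}.
HB.instance Definition _ := SubChoice.on qpath.

Implicit Types p q : qpath.

Definition psrc p : vertex Q := (val p).1.
Definition parr p : seq (arrow Q) := (val p).2.
Definition ptgt p : vertex Q := walk_end (psrc p) (parr p).
Definition plen p : nat := size (parr p).
Definition pverts p : seq (vertex Q) := psrc p :: [seq tgt a | a <- parr p].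

Lemma is_walk0 v : is_walk v [::]. Proof. by []. Qed.
Lemma is_walk1 a : is_walk (src a) [:: a]. Proof. by rewrite /= eqxx. Qed.

Definition vpath v : qpath := exist _ (v, [::]) (is_walk0 v).
Definition apath a : qpath := exist _ (src a, [:: a]) (is_walk1 a).

(* The composite "q after p". *)
Definition pcomp q p : option qpath :=
  if psrc q == ptgt p then (insub (psrc p, parr p ++ parr q) : option qpath)
  else None.

Lemma is_walk_cat v s1 s2 :
  is_walk v (s1 ++ s2) = is_walk v s1 && is_walk (walk_end v s1) s2.
Proof. by elim: s1 v => //= a s1 IH v; rewrite IH andbA. Qed.

Lemma walk_end_cat v s1 s2 :
  walk_end v (s1 ++ s2) = walk_end (walk_end v s1) s2.
Proof. by rewrite /walk_end map_cat last_cat. Qed.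

Lemma qpath_eq p q : psrc p = psrc q -> parr p = parr q -> p = q.
Proof.
rewrite /psrc /parr => e1 e2; apply/val_inj.
by move: e1 e2; case: (val p) => ? ?; case: (val q) => ? ? /= -> ->.
Qed.

Lemma pcompP q p : psrc q = ptgt p ->
  exists2 r, pcomp q p = Some r &
    [/\ psrc r = psrc p, ptgt r = ptgt q & parr r = parr p ++ parr q].
Proof.
move=> qp; rewrite /pcomp qp eqxx.
have w : is_walk (psrc p) (parr p ++ parr q).
  by rewrite is_walk_cat -/(ptgt p) -qp (valP q) (valP p).
exists (exist _ (psrc p, parr p ++ parr q) w : qpath).
  case: insubP => [u _ eu|]; last by rewrite /= w.
  by congr Some; apply/val_inj.
by rewrite /ptgt {1 2}/psrc {1 2}/parr /= walk_end_cat -/(ptgt p) qp.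
Qed.

Lemma pcompN q p : psrc q != ptgt p -> pcomp q p = None.
Proof. by rewrite /pcomp => /negbTE->. Qed.

Lemma pcompA r q p : obind (pcomp r) (pcomp q p) = obind (fun t => pcomp t p) (pcomp r q).
Proof.
have [qp|nqp] := eqVneq (psrc q) (ptgt p); last first.
  rewrite (pcompN nqp) /=.
  have [/pcompP[s -> [s1 _ _]]|/pcompN->//] := eqVneq (psrc r) (ptgt q).
  by rewrite /= pcompN // s1.
have [t -> [t1 t2 t3]] := pcompP qp.
have [rq|nrq] := eqVneq (psrc r) (ptgt q); last first.
  by rewrite (pcompN nrq) /= pcompN // t2.
have [s -> [s1 s2 s3]] := pcompP rq; rewrite /=.
have [u -> [u1 u2 u3]] := pcompP (etrans rq (esym t2)).
have [w -> [w1 w2 w3]] := pcompP (etrans s1 qp).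
congr Some; apply: qpath_eq; first by rewrite u1 t1 w1.
by rewrite u3 t3 w3 s3 catA.
Qed.

Lemma pcomp_vl v p : pcomp (vpath v) p = if v == ptgt p then Some p else None.
Proof.
have [vp|] := eqVneq v (ptgt p); last exact: (@pcompN (vpath v)).
have [r -> [r1 _ r3]] := @pcompP (vpath v) p vp.
by congr Some; apply: qpath_eq => //; rewrite r3 cats0.
Qed.

Lemma pcomp_vr v p : pcomp p (vpath v) = if v == psrc p then Some p else None.
Proof.
have [vp|nvp] := eqVneq v (psrc p); last first.
  by apply: (@pcompN p (vpath v)); rewrite eq_sym.
have [r -> [r1 _ r3]] := @pcompP p (vpath v) (esym vp).
by congr Some; apply: qpath_eq; rewrite // r1 -vp.
Qed.

End Paths.

Definition path_algebra (K : fieldType) (Q : quiver) : Type := {malg K[qpath Q]}.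

HB.instance Definition _ (K : fieldType) (Q : quiver) :=
  GRing.Lmodule.on (path_algebra K Q).

HB.lock Definition pathelt (K : fieldType) (Q : quiver) (p : qpath Q) :
  path_algebra K Q := << p >>.

Definition pathopt (K : fieldType) (Q : quiver) (o : option (qpath Q)) :
  path_algebra K Q := oapp (@pathelt K Q) 0 o.

Definition lext (K : fieldType) (Q : quiver) (F : qpath Q -> path_algebra K Q)
  (x : path_algebra K Q) : path_algebra K Q := \sum_(p <- msupp x) x@_p *: F p.

(* The product of two paths q and p is "q after p", or 0 if they do not compose. *)
HB.lock Definition pa_mul (K : fieldType) (Q : quiver) (x y : path_algebra K Q) :
    path_algebra K Q :=
  lext (fun q => lext (fun p => pathopt K (pcomp q p)) y) x.

Definition pa_one (K : fieldType) (Q : quiver) : path_algebra K Q :=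
  \sum_(v : vertex Q) pathelt K (vpath v).

Section PathAlgebra.
Variables (K : fieldType) (Q : quiver).

Notation KQ := (path_algebra K Q).
Notation pathelt := (@pathelt K Q).
Notation pathopt := (@pathopt K Q).
Notation pa_mul := (@pa_mul K Q).
Notation pa_one := (pa_one K Q).
Implicit Types (x y z : KQ) (F G : qpath Q -> KQ).

Lemma lextw F x (d : {fset qpath Q}) :
  (msupp x `<=` d)%fset -> lext F x = \sum_(p <- d) x@_p *: F p.
Proof.
move=> xd; apply: big_fset_incl xd _ => p _ /mcoeff_outdom ->.
by rewrite scale0r.
Qed.

Lemma lext_is_linear F : linear (lext F).
Proof.
move=> c x y; pose d := (msupp x `|` msupp y)%fset.
have dx : (msupp x `<=` d)%fset by apply: fsubsetUl.
have dy : (msupp y `<=` d)%fset by apply: fsubsetUr.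
have dxy : (msupp (c *: x + y) `<=` d)%fset.
  apply: fsubset_trans (msuppD_le _ _) _; rewrite fsubUset dy andbT.
  exact: fsubset_trans (msuppZ_le _ _) dx.
rewrite (lextw F dx) (lextw F dy) (lextw F dxy) scaler_sumr -big_split /=.
by apply: eq_bigr => p _; rewrite mcoeffD mcoeffZ scalerDl scalerA.
Qed.

HB.instance Definition _ F :=
  GRing.isLinear.Build K KQ KQ *:%R (lext F) (lext_is_linear F).

Lemma eq_lext F G : F =1 G -> lext F =1 lext G.
Proof. by move=> FG x; apply: eq_bigr => p _; rewrite FG. Qed.

Lemma lext_lin F G c x :
  lext (fun p => c *: F p + G p) x = c *: lext F x + lext G x.
Proof.
rewrite /lext scaler_sumr -big_split /=; apply: eq_bigr => p _.
by rewrite scalerDr !scalerA mulrC.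
Qed.

Lemma lext_elt F p : lext F (pathelt p) = F p.
Proof.
rewrite pathelt.unlock (lextw F (d := [fset p]%fset)) ?msuppU_le //.
by rewrite big_seq_fset1 mcoeffUU scale1r.
Qed.

Lemma pathelt_sum x : x = \sum_(p <- msupp x) x@_p *: pathelt p.
Proof.
rewrite pathelt.unlock {1}[x]monalgE; apply: eq_bigr => p _; apply/malgP => q.
by rewrite (mcoeffZ x@_p << p >> q) [LHS]mcoeffU mcoeffU mulr_natr.
Qed.

Lemma lin_ext (f g : KQ -> KQ) : linear f -> linear g ->
  (forall p, f (pathelt p) = g (pathelt p)) -> f =1 g.
Proof.
move=> lf lg fg x.
pose hf := HB.pack_for {linear KQ -> KQ} f (GRing.isLinear.Build _ _ _ _ f lf).
pose hg := HB.pack_for {linear KQ -> KQ} g (GRing.isLinear.Build _ _ _ _ g lg).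
rewrite -[f]/(hf : _ -> _) -[g]/(hg : _ -> _) (pathelt_sum x) !linear_sum.
by apply: eq_bigr => p _; rewrite !linearZ /= fg.
Qed.

Lemma lin_comp (f g : KQ -> KQ) : linear f -> linear g -> linear (g \o f).
Proof. by move=> lf lg c x y; rewrite /= lf lg. Qed.

Lemma pa_mul_linl y : linear (pa_mul^~ y).
Proof. by move=> c x z; rewrite pa_mul.unlock linearP. Qed.

Lemma pa_mul_linr x : linear (pa_mul x).
Proof.
move=> c y z; rewrite pa_mul.unlock.
pose F w q := lext (fun p => pathopt (pcomp q p)) w.
rewrite -[RHS](lext_lin (F y) (F z)).
by apply: eq_lext => q; rewrite /F linearP.
Qed.

Lemma pa_mulE q p : pa_mul (pathelt q) (pathelt p) = pathopt (pcomp q p).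
Proof. by rewrite pa_mul.unlock !lext_elt. Qed.

Lemma pa_mul0l y : pa_mul 0 y = 0. Proof. by rewrite pa_mul.unlock linear0. Qed.
Lemma pa_mul0r x : pa_mul x 0 = 0.
Proof. by have := pa_mul_linr x (-1) 0 0; rewrite !scaleN1r oppr0 addr0 addNr. Qed.

Lemma pa_mulopt_r q o :
  pa_mul (pathelt q) (pathopt o) = pathopt (obind (pcomp q) o).
Proof. by case: o => [p|] /=; [exact: pa_mulE | exact: pa_mul0r]. Qed.

Lemma pa_mulopt_l o p :
  pa_mul (pathopt o) (pathelt p) = pathopt (obind (fun q => pcomp q p) o).
Proof. by case: o => [q|] /=; [exact: pa_mulE | exact: pa_mul0l]. Qed.

Lemma pa_mulA : associative pa_mul.
Proof.
move=> x y z; move: x.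
apply: (@lin_ext (pa_mul^~ (pa_mul y z)) (pa_mul^~ z \o pa_mul^~ y)).
- exact: pa_mul_linl.
- exact: lin_comp (pa_mul_linl y) (pa_mul_linl z).
move=> r; move: y.
apply: (@lin_ext (pa_mul (pathelt r) \o pa_mul^~ z)
                 (pa_mul^~ z \o pa_mul (pathelt r))).
- exact: lin_comp (pa_mul_linl z) (pa_mul_linr (pathelt r)).
- exact: lin_comp (pa_mul_linr (pathelt r)) (pa_mul_linl z).
move=> q; move: z.
apply: (@lin_ext (pa_mul (pathelt r) \o pa_mul (pathelt q))
                 (pa_mul (pa_mul (pathelt r) (pathelt q)))).
- exact: lin_comp (pa_mul_linr (pathelt q)) (pa_mul_linr (pathelt r)).
- exact: pa_mul_linr.
move=> p /=; rewrite (pa_mulE q p) (pa_mulE r q).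
rewrite pa_mulopt_r pa_mulopt_l; congr pathopt; exact: pcompA.
Qed.

Lemma pa_mul1l : left_id pa_one pa_mul.
Proof.
apply: (@lin_ext (pa_mul pa_one) id) => //; first exact: pa_mul_linr.
move=> p; rewrite pa_mul.unlock /pa_one linear_sum /= (bigD1 (ptgt p)) //=.
rewrite !lext_elt pcomp_vl eqxx big1 ?addr0 // => v nv.
by rewrite !lext_elt pcomp_vl (negbTE nv).
Qed.

Lemma pa_mul1r : right_id pa_one pa_mul.
Proof.
apply: (@lin_ext (pa_mul^~ pa_one) id) => //; first exact: pa_mul_linl.
move=> p; rewrite pa_mul.unlock lext_elt /pa_one linear_sum /= (bigD1 (psrc p)) //=.
rewrite !lext_elt pcomp_vr eqxx big1 ?addr0 // => v nv.
by rewrite !lext_elt pcomp_vr (negbTE nv).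
Qed.

Lemma pa_mulDl : left_distributive pa_mul +%R.
Proof. by move=> x y z; have := pa_mul_linl z 1 x y; rewrite !scale1r. Qed.

Lemma pa_mulDr : right_distributive pa_mul +%R.
Proof. by move=> x y z; have := pa_mul_linr x 1 y z; rewrite !scale1r. Qed.

Lemma pathelt_coef p q : (pathelt p)@_q = (p == q)%:R.
Proof. by rewrite pathelt.unlock mcoeffU. Qed.

Lemma pa_one_coef v : pa_one@_(vpath v) = 1.
Proof.
have e (w : vertex Q) : (pathelt (vpath w))@_(vpath v) = (w == v)%:R.
  by rewrite pathelt_coef; congr (nat_of_bool _)%:R; apply/eqP/eqP => [[]|->].
rewrite /pa_one (raddf_sum (mcoeff (vpath v))) (eq_bigr _ (fun w _ => e w)).
by rewrite (bigD1 v) //= eqxx big1 ?addr0 // => w /negbTE->.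
Qed.

Lemma pa_one_neq0 : pa_one != 0.
Proof.
have /card_gt0P[v _] := quiver_nonempty Q.
apply/eqP => one0; have := pa_one_coef v; rewrite one0 mcoeff0.
by move/eqP; rewrite eq_sym oner_eq0.
Qed.

Lemma pa_mulZl c x y : pa_mul (c *: x) y = c *: pa_mul x y.
Proof. by rewrite -[c *: x]addr0 (pa_mul_linl y) pa_mul0l addr0. Qed.

Lemma pa_mulZr c x y : pa_mul x (c *: y) = c *: pa_mul x y.
Proof. by rewrite -[c *: y]addr0 (pa_mul_linr x) pa_mul0r addr0. Qed.

HB.instance Definition _ := GRing.Zmodule_isNzRing.Build KQ
  pa_mulA pa_mul1l pa_mul1r pa_mulDl pa_mulDr pa_one_neq0.

Lemma pa_scalerAl (c : K) (x y : KQ) : c *: (x * y) = (c *: x) * y.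
Proof. exact: esym (pa_mulZl c x y). Qed.

Lemma pa_scalerAr (c : K) (x y : KQ) : c *: (x * y) = x * (c *: y).
Proof. exact: esym (pa_mulZr c x y). Qed.

Lemma patheltM q p : pathelt q * pathelt p = pathopt (pcomp q p).
Proof. exact: pa_mulE. Qed.

HB.instance Definition _ := GRing.Lmodule_isLalgebra.Build K KQ pa_scalerAl.
HB.instance Definition _ := GRing.Lalgebra_isAlgebra.Build K KQ pa_scalerAr.

End PathAlgebra.

Section Admissible.
Variables (K : fieldType) (Q : quiver).

Definition two_sided_ideal (I : set (path_algebra K Q)) : Prop :=
  [/\ I 0, forall x y, I x -> I y -> I (x + y)
     & forall a x, I x -> I (a * x) /\ I (x * a)].

(* The m-th power of the ideal generated by the arrows, i.e. the K-span of the
   paths of length at least m. *)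
Definition arrow_ideal_pow (m : nat) : set (path_algebra K Q) :=
  [set x | forall p : qpath Q, p \in msupp x -> (m <= plen p)%N].

Definition admissible (I : set (path_algebra K Q)) : Prop :=
  two_sided_ideal I /\
  exists2 m, (2 <= m)%N &
    arrow_ideal_pow m `<=` I /\ I `<=` arrow_ideal_pow 2.

End Admissible.

Definition no_directed_cycle (Q : quiver) : Prop :=
  forall p : qpath Q, psrc p = ptgt p -> plen p = 0%N.

Arguments no_directed_cycle Q : clear implicits.

Section Submodules.
Variables (A : nzRingType) (M : lmodType A).
Implicit Types N P L X : set M.

Definition is_submod N : Prop := submod_closed [in N].

Definition submod_span X : set M :=
  [set x | forall N, is_submod N -> X `<=` N -> N x].

Lemma submod_span_is_submod X : is_submod (submod_span X).
Proof.
split=> [|a x y]; rewrite !inE.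
  by move=> N sN _; have := sN.1; rewrite inE.
move=> sx sy N sN XN; have := sN.2 a x y; rewrite !inE; apply.
  exact: sx.
exact: sy.
Qed.

Definition fin_generated : Prop :=
  exists s : seq M, submod_span [set` s] = [set: M].

(* L is a submodule of P and P/L is simple. *)
Definition simple_factor L P : Prop :=
  [/\ is_submod L, is_submod P, L `<=` P, L <> P
    & forall N, is_submod N -> L `<=` N -> N `<=` P -> N = L \/ N = P].

Fixpoint comp_chain L (c : seq (set M)) N : Prop :=
  if c is P :: c' then simple_factor L P /\ comp_chain P c' N else L = N.

(* c lists the successive terms above 0 of a composition series of N, so that
   the length of the series is size c. *)
Definition comp_series N (c : seq (set M)) : Prop := comp_chain [set 0] c N.

Definition uniserial N : Prop := exists! c, comp_series N c.

Definition has_length N (n : nat) : Prop := exists2 c, comp_series N c & size c = n.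

Definition smul (X : set A) N : set M :=
  submod_span [set x *: y | x in X & y in N].

Lemma smul_is_submod (X : set A) N : is_submod (smul X N).
Proof. exact: submod_span_is_submod. Qed.

End Submodules.

Definition simple_module (A : nzRingType) (M : lmodType A) : Prop :=
  simple_factor [set 0 : M] [set: M].

Arguments fin_generated {A} M.
Arguments simple_module {A} M.

Section SubmodType.
Variables (A : nzRingType) (M : lmodType A) (N : set M) (sN : is_submod N).

Definition submod_type of is_submod N : Type := {x : M | x \in N}.
Notation T := (submod_type sN).

HB.instance Definition _ := SubChoice.on T.
HB.instance Definition _ := GRing.SubChoice_isSubLmodule.Build A M [in N] T
  (GRing.submod_closed_semi sN).

Definition submod_incl : {linear T -> M} := \val.

End SubmodType.

Section Irreducible.
Variables (A : nzRingType).

Definition split_mono (M N : lmodType A) (f : {linear M -> N}) : Prop :=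
  exists g : {linear N -> M}, cancel f g.

Definition split_epi (M N : lmodType A) (f : {linear M -> N}) : Prop :=
  exists g : {linear N -> M}, cancel g f.

Definition irreducible_map (M N : lmodType A) (f : {linear M -> N}) : Prop :=
  [/\ ~ split_mono f, ~ split_epi f
    & forall (X : lmodType A) (g : {linear X -> N}) (h : {linear M -> X}),
        fin_generated X -> f =1 g \o h -> split_mono h \/ split_epi g].

End Irreducible.

Section Rings.
Variable A : nzRingType.

(* The intersection of the maximal left ideals; left ideals of A are the
   submodules of the regular module A^o. *)
Definition jacobson : set A :=
  [set x | forall m : set A^o, simple_factor m [set: A^o] -> m x].

Definition jacobson2 : set A := smul jacobson (jacobson : set A^o).

Definition primitive_idempotent (e : A) : Prop :=
  [/\ e != 0, e * e = e
    & forall f g : A, f * f = f -> g * g = g -> f * g = 0 -> g * f = 0 ->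
        e = f + g -> f = 0 \/ g = 0].

Definition mulsetr (X : set A) (a : A) : set A := [set x * a | x in X].
Definition mulsetl (a : A) (X : set A) : set A := [set a * x | x in X].

Definition left_multiserial : Prop :=
  forall e : A, primitive_idempotent e ->
    exists2 F : set (set A^o), (forall S, F S -> uniserial S)
      & mulsetr jacobson e = submod_span (\bigcup_(S in F) S).

End Rings.

Arguments jacobson A : clear implicits.
Arguments jacobson2 A : clear implicits.
Arguments left_multiserial A : clear implicits.

(* The classes modulo W of the elements of X form a K-basis of V/W: the n classes
   in the independence clause are required to be pairwise distinct, the elements
   of X need not represent distinct classes. *)
Definition basis_mod (K : fieldType) (A : lmodType K) (V W X : set A) : Prop :=
  [/\ X `<=` V,
      forall v, V v -> exists n (c : 'I_n -> K) (x : 'I_n -> A),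
        (forall i, X (x i)) /\ W (v - \sum_i c i *: x i)
    & forall n (c : 'I_n -> K) (x : 'I_n -> A),
        (forall i, X (x i)) -> (forall i j, W (x i - x j) -> i = j) ->
        W (\sum_i c i *: x i) -> forall i, c i = 0].

(* pi exhibits A as the quotient of the path algebra by I. *)
Definition is_quotient_map (K : fieldType) (Q : quiver) (A : algType K)
    (pi : {lrmorphism path_algebra K Q -> A}) (I : set (path_algebra K Q)) : Prop :=
  (forall a, exists x, pi x = a) /\ (forall x, pi x = 0 <-> I x).

Section Mast.
Variables (K : fieldType) (Q : quiver) (A : algType K).
Variable pi : {lrmorphism path_algebra K Q -> A}.

Definition is_mast (U : lmodType A) (p : qpath Q) : Prop :=
  has_length [set: U] (plen p).+1 /\ exists x : U, pi (pathelt K p) *: x != 0.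

Definition arrow_cls (a : arrow Q) : A := pi (pathelt K (apath a)).

(* The product a_m ... a_1 of s = [:: a_1; ..; a_m]; it is 1 when s is empty. *)
Definition arrow_prod (s : seq (arrow Q)) : A := \prod_(a <- rev s) arrow_cls a.

Variable p : qpath Q.

(* For p without repeated vertices, with vertices 1, .., n and v in position k:
   alpha_(k-1) ... alpha_1. *)
Definition path_upto (v : vertex Q) : A :=
  arrow_prod (take (index v (pverts p)) (parr p)).

(* Likewise alpha_(n-1) ... alpha_k. *)
Definition path_from (v : vertex Q) : A :=
  arrow_prod (drop (index v (pverts p)) (parr p)).

End Mast.

Section ArrowSets.
Variables (Q : quiver) (p : qpath Q).

(* {1, .., n-1} is [take (plen p) (pverts p)], {2, .., n} is
   [behead (pverts p)]. *)
Definition arrB : pred (arrow Q) := [pred b |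
  (src b \in take (plen p) (pverts p)) && (tgt b \notin pverts p)].

Definition arrC : pred (arrow Q) := [pred c |
  (src c \notin pverts p) && (tgt c \in behead (pverts p))].

Definition arrD : pred (arrow Q) := [pred d |
  [&& src d \in pverts p, tgt d \in pverts p & d \notin parr p]].

End ArrowSets.

(* Main.v *)
Require Import Defs.
From HB Require Import structures.
From mathcomp Require Import all_boot all_algebra.
From mathcomp Require Import finmap monalg.
From mathcomp Require Import boolp classical_sets.

Set Implicit Arguments.
Unset Strict Implicit.
Unset Printing Implicit Defensive.

Import GRing.Theory.
Local Open Scope ring_scope.
Local Open Scope classical_set_scope.

(** Let [1] and [n] be the ends of the mast [p], let [e_v] be the idempotent of a
    vertex [v], let [u] be a top element of [U], so that [e_1 u = u] and
    [p u <> 0], and let [u_v] be the image of [u] under the initial part of [p]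
    that ends in [v].

    The shape of [U].  A simple module is a line at a single vertex
    ([simple_factorP]).  A composition series of [U] has as many factors as [p]
    has vertices, and the [u_v] are nonzero vectors at these distinct vertices,
    so they leave no room for anything else ([comp_chain_count]): [U] is the
    direct sum of the lines [K u_v].  It is thus described by the scalars
    [struct a] with which the arrows act, and the linear maps from [U] or to [U]
    are the families that respect these scalars ([hom_from_mast],
    [hom_to_mast]).  With [f_v] the final part of [p] that starts in [v], the
    elements [relator a = f_t(a) a - struct a f_s(a)] annihilate [U].

    Sufficiency.  Condition (a) says that [u] has annihilator [Jp] in
    [Lambda e_1], so every [y] in [e_1 X] with [Jpy = 0] is the image of [u]
    under a linear map from [U] to [X] ([mast_universal]).  Let the embedding of
    [JU] be the composite of [h : JU -> X] and [g : X -> U].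
    If [h (p u)] is not of the form [p x_1 + \sum_a relator a x_a], then a
    functional that vanishes on all elements of this form and is 1 at [h (p u)]
    is the coordinate at [n] of a retraction of [h]
    ([split_mono_of_notin_image]).  If it is of this form, then (b) provides
    [w_a] in [J] with [r (relator a) = r p w_a] for every [r] in [R]
    ([relator_shift]); the element [y = e_1 (x_1 + \sum_a w_a x_a)] is then
    killed by [Rp], hence by [Jp] ([nakayama]), and [g y = u], so that sending
    [u] to [y] splits [g] ([split_epi_of_in_image]).

    Necessity.  Factor the embedding through the module [X] generated by [JU] and
    free generators [x] and [y_a] with the single relation
    [p u = p x - \sum_a relator a y_a], where [X -> U] sends [x] to [u] and [y_a]
    to 0 ([test_module]).  A retraction of [JU -> X] would give [p u = 0],
    because [p] kills [JU] and the relators kill [U].  So [X -> U] splits, and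
    comparing annihilators of [u] and of its image yields, for each [s] that
    kills [u], some [t] in [J] with [s e_1 = t p] and with the products
    [t (relator a)] equal to [t p nu_a] for elements [nu_a] that do not depend
    on [s] ([annihilator_lift]).  The first equation is (a); both together, for
    [s] the product of an arrow and [p], provide the set [R] of (b). *)

(** * Submodules, linear maps and quotients *)

Section Submod.
Variables (A : nzRingType) (M : lmodType A).
Implicit Types N L P : set M.

Lemma is_submodP N :
  is_submod N <->
  [/\ N 0, forall x y, N x -> N y -> N (x + y) & forall a x, N x -> N (a *: x)].
Proof.
split=> [[]|[N0 ND NZ]].
  rewrite inE => N0 Nl; split=> // [x y Nx Ny|a x Nx].
    by have := Nl 1 x y; rewrite !inE scale1r; apply.
  by have := Nl a x 0; rewrite !inE addr0; apply.
by split=> [|a x y]; rewrite !inE // => Nx Ny; apply/ND/Ny/NZ.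
Qed.

Lemma submodB N x y : is_submod N -> N x -> N y -> N (x - y).
Proof.
by case/is_submodP=> _ ND NZ Nx Ny; apply: ND => //; rewrite -scaleN1r; apply: NZ.
Qed.

Lemma submod_sum N (I : Type) (r : seq I) (P : pred I) (F : I -> M) :
  is_submod N -> (forall i, P i -> N (F i)) -> N (\sum_(i <- r | P i) F i).
Proof. by case/is_submodP=> N0 ND _ NF; apply: big_ind. Qed.

Lemma sub_submod_span (X : set M) : X `<=` submod_span X.
Proof. by move=> x Xx N _; apply. Qed.

Lemma submod_setT : is_submod [set: M].
Proof. exact/is_submodP. Qed.

Lemma submod_set0 : is_submod [set 0 : M].
Proof.
apply/is_submodP; split=> //= [x y -> ->|a x ->]; first by rewrite addr0.
by rewrite scaler0.
Qed.

Lemma simple_factor_eqT L P N z :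
  simple_factor L P -> is_submod N -> L `<=` N -> N `<=` P -> N z -> ~ L z ->
  N = P.
Proof. by case=> _ _ _ _ h sN LN NP Nz Lz; case: (h N sN LN NP) => // NL; rewrite NL in Nz. Qed.

End Submod.

Lemma linear_of (A : nzRingType) (M N : lmodType A) (f : M -> N) :
  linear f -> exists g : {linear M -> N}, g =1 f.
Proof.
by move=> lf; exists (HB.pack_for {linear M -> N} f (GRing.isLinear.Build _ _ _ _ f lf)).
Qed.

(** Among the subspaces that contain [W] and avoid [z] there is a maximal one by
    Zorn's lemma; maximality makes it a complement of the line [K z], and the
    functional is the projection onto that line. *)
Lemma separating_functional (K : fieldType) (V : lmodType K) (W : set V) (z : V) :
  is_submod W -> ~ W z ->
  exists f : {linear V -> K^o}, (forall w, W w -> f w = 0) /\ f z = 1.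
Proof.
move=> sW Wz.
pose good (S : set V) := [/\ is_submod S, W `<=` S & ~ S z].
have [|S [[S0|[sS WS Sz]] Smax]] := @Zorn_bigcup V [set S | S = set0 \/ good S].
(* The empty chain has union [set0], which is why [set0] is admitted to the
   family although it is no subspace. *)
- move=> F Fgood Ftot.
  have [[S0 FS0 gS0]|noS] := pselect (exists2 S, F S & good S); last first.
    left; apply/seteqP; split=> // x [S FS Sx].
    by case: (Fgood S FS) => [SE|gS]; [rewrite SE in Sx | case: noS; exists S].
  right; split.
  + apply/is_submodP; split.
    * by exists S0 => //; case: gS0 => /is_submodP[].
    * move=> x y [S FS Sx] [T FT Ty].
      have Fsub X : F X -> X !=set0 -> is_submod X.
        move=> /Fgood[->|[]//] [? []].
      have sS := Fsub S FS (ex_intro _ _ Sx); have sT := Fsub T FT (ex_intro _ _ Ty).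
      have /is_submodP[_ SD _] := sS; have /is_submodP[_ TD _] := sT.
      by case: (Ftot S T FS FT) => ST; [exists T | exists S] => //;
         [apply: TD => //; apply: ST | apply: SD => //; apply: ST].
    * move=> a x [S FS Sx]; exists S => //.
      by case: (Fgood S FS) => [SE|[/is_submodP[_ _ SZ] _ _]]; [rewrite SE in Sx | apply: SZ].
  + by move=> w Ww; exists S0 => //; case: gS0 => _ WS _; apply: WS.
  + by move=> [S FS]; case: (Fgood S FS) => [->|[]].
- exfalso; apply: (Smax W); last by right; split.
  have /is_submodP[W0 _ _] := sW; rewrite S0.
  by split=> // /(_ 0 W0).
have /is_submodP[SS0 SD SZ] := sS.
have co x : exists c : K, S (x - c *: z).
  have [Sx|Sx] := pselect (S x); first by exists 0; rewrite scale0r subr0.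
  pose T : set V := [set y | exists2 s, S s & exists c : K, y = s + c *: x].
  have sT : is_submod T.
    apply/is_submodP; split.
    + by exists 0 => //; exists 0; rewrite scale0r addr0.
    + move=> _ _ [s Ss [c ->]] [t St [d ->]]; exists (s + t); first exact: SD.
      by exists (c + d); rewrite scalerDl addrACA.
    + move=> a _ [s Ss [c ->]]; exists (a *: s); first exact: SZ.
      by exists (a * c); rewrite scalerDr scalerA.
  have ST : S `<=` T by move=> s Ss; exists s => //; exists 0; rewrite scale0r addr0.
  have [|noTz] := pselect (T z).
    case=> s Ss [c zE]; have c0 : c != 0.
      by apply/eqP => c0; apply: Sz; rewrite zE c0 scale0r addr0.
    exists c^-1; rewrite zE scalerDr scalerA mulVf // scale1r opprD addrCA subrr addr0.
    by rewrite -scaleN1r scalerA; apply: SZ.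
  exfalso; apply: (Smax T); last by right; split=> // w /WS /ST.
  split=> // TS; apply/Sx/TS; exists 0 => //.
  by exists 1; rewrite scale1r add0r.
have cu x c d : S (x - c *: z) -> S (x - d *: z) -> c = d.
  move=> Sc Sd; have [//|cd] := eqVneq c d; exfalso; apply: Sz.
  have := submodB sS Sd Sc.
  rewrite opprD opprK addrACA subrr add0r addrC -scalerBl => /(SZ (c - d)^-1).
  by rewrite scalerA mulVf ?scale1r // subr_eq0.
pose f x := sval (cid (co x)).
have fP x : S (x - f x *: z) by rewrite /f; case: cid.
have [|g gE] := @linear_of _ V (K^o : lmodType K) f.
  move=> a x y; apply: (cu (a *: x + y)) => //.
  have -> : a *: x + y - ((a *: (f x : K^o) + f y) : K) *: z
            = a *: (x - f x *: z) + (y - f y *: z).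
    by rewrite scalerDl scalerBr scalerA opprD addrACA.
  by apply: SD => //; apply: SZ.
exists g; split=> [w Ww|]; rewrite gE.
  by apply: (cu w) => //; rewrite scale0r subr0; apply: WS.
by apply: (cu z) => //; rewrite scale1r subrr.
Qed.

Section Quotient.
Variables (A : nzRingType) (M : lmodType A).

Lemma linear_factor (X P : lmodType A) (g : {linear M -> X}) (f : {linear M -> P}) :
  (forall y, exists x, g x = y) -> (forall x, g x = 0 -> f x = 0) ->
  exists h : {linear X -> P}, forall x, h (g x) = f x.
Proof.
move=> gsurj gf; pose r y := sval (cid (gsurj y)).
have rK y : g (r y) = y by rewrite /r; case: cid.
have fE x y : g x = g y -> f x = f y.
  by move=> /eqP; rewrite -subr_eq0 -linearB => /eqP/gf/eqP; rewrite linearB subr_eq0 => /eqP.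
have [|h hE] := @linear_of _ X P (f \o r).
  by move=> a x y /=; rewrite -linearP; apply: fE; rewrite linearP !rK.
by exists h => x; rewrite hE /=; apply: fE; rewrite rK.
Qed.

Variable N : set M.
Hypothesis sN : is_submod N.

Let Nin : {pred M} := [in N].
Let Nin_closed : zmod_closed Nin.
Proof.
split=> [|x y]; rewrite /Nin !inE; first by case/is_submodP: sN.
by move=> Nx Ny; apply: submodB.
Qed.
Let Nz : zmodClosed M := HB.pack Nin (GRing.isZmodClosed.Build M Nin Nin_closed).
Let NzE x : (x \in Nz) = (x \in N). Proof. by []. Qed.

Local Open Scope quotient_scope.
Local Notation Q := (ring_quotient.Quotient.quot Nz).
Let p (x : M) : Q := \pi_Q x.

Let pE x y : p x = p y <-> N (x - y).
Proof.
split=> [pxy|Nxy].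
  have : x - y \in Nz by rewrite ring_quotient.Quotient.idealrBE; apply/eqP.
  by rewrite NzE inE.
by apply/eqP; rewrite -ring_quotient.Quotient.idealrBE NzE inE.
Qed.

Let sc a (x : Q) : Q := p (a *: repr x).

Let scp a x : sc a (p x) = p (a *: x).
Proof.
apply/pE; rewrite -scalerBr; case/is_submodP: sN => _ _; apply.
by apply/pE; rewrite /p reprK.
Qed.
Let pD x y : p (x + y) = p x + p y. Proof. exact: raddfD. Qed.
Let psurj (y : Q) : exists x, p x = y. Proof. by exists (repr y); rewrite /p reprK. Qed.

Let scA a b v : sc a (sc b v) = sc (a * b) v.
Proof. by have [x <-] := psurj v; rewrite !scp scalerA. Qed.
Let sc1 : left_id 1 sc.
Proof. by move=> v; have [x <-] := psurj v; rewrite !scp scale1r. Qed.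
Let scDr : right_distributive sc +%R.
Proof.
move=> a v w; have [x <-] := psurj v; have [y <-] := psurj w.
by rewrite -pD !scp -pD scalerDr.
Qed.
Let scDl v : {morph sc^~ v : a b / a + b}.
Proof. by move=> a b; have [x <-] := psurj v; rewrite !scp -pD scalerDl. Qed.

(** The additive quotient carries the scaling that is computed on
    representatives; it is well defined because [N] absorbs scalars. *)
Lemma quotient_module : exists (X : lmodType A) (g : {linear M -> X}),
  (forall y, exists x, g x = y) /\ (forall x, g x = 0 <-> N x).
Proof.
pose X : lmodType A := HB.pack Q
  (GRing.Zmodule_isLmodule.Build A Q scA sc1 scDr scDl).
have [|g gE] := @linear_of _ M X p.
  by move=> a x y; rewrite pD; congr (_ + _); rewrite -scp.
exists X, g; split=> [y|x]; first by have [x <-] := psurj y; exists x; rewrite gE.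
have p0 : p 0 = 0 by apply: raddf0.
by rewrite gE -[X in _ <-> N X]subr0 -pE p0.
Qed.

End Quotient.

Lemma corestrict (A : nzRingType) (X M : lmodType A) (N : set M) (sN : is_submod N)
    (f : {linear X -> M}) :
  (forall x, N (f x)) ->
  exists g : {linear X -> submod_type sN}, forall x, submod_incl sN (g x) = f x.
Proof.
move=> Nf; pose g x : submod_type sN := exist _ (f x) (mem_set (Nf x)).
have [|g' g'E] := @linear_of _ X (submod_type sN) g.
  by move=> a x y; apply: val_inj; rewrite /= linearP.
by exists g' => x; rewrite g'E.
Qed.

(** An index set of least cardinality among those that still span gives a basis:
    a relation with a nonzero coefficient at some index would allow to remove
    that index. *)
Lemma basis_mod_of_spanning (K : fieldType) (V : lmodType K) (N W : set V)
    (T : finType) (f : T -> V) :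
  is_submod W -> (forall t, N (f t)) ->
  (forall v, N v -> exists c : T -> K, W (v - \sum_t c t *: f t)) ->
  exists S : {set T}, basis_mod N W [set f t | t in [set t | t \in S]].
Proof.
move=> sW Nf span; have /is_submodP[W0 WD WZ] := sW.
pose spans (S : {set T}) :=
  forall v, N v -> exists c : T -> K, W (v - \sum_(t in S) c t *: f t).
have spansT : `[< spans [set: T]%SET >].
  apply/asboolP => v /span[c Wc]; exists c.
  by rewrite (eq_bigl xpredT) // => t; rewrite finset.in_setT.
have [S /asboolP sS Smin] := @arg_minnP _ [set: T]%SET (fun S => `[< spans S >])
  (fun S : {set T} => #|S|) spansT.
exists S; split.
- by move=> _ [t _ <-].
- move=> v /sS[c Wc]; exists #|S|, (c \o enum_val), (f \o enum_val); split.
    by move=> i; exists (enum_val i) => //; apply: enum_valP.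
  by rewrite big_enum_val in Wc.
move=> n c x Sx xW Wcx i0; have [//|c0] := eqVneq (c i0) 0; exfalso.
pose tau i := sval (cid2 (Sx i)).
have tauS i : tau i \in S by rewrite /tau; case: cid2.
have ftau i : f (tau i) = x i by rewrite /tau; case: cid2.
have tau_inj : injective tau by move=> i j tij; apply: xW; rewrite -!ftau tij subrr.
pose d t := \sum_(i | tau i == t) c i.
have dE : \sum_i c i *: x i = \sum_(t in S) d t *: f t.
  rewrite (partition_big tau (mem S)) //=; apply: eq_bigr => t _.
  by rewrite scaler_suml; apply: eq_bigr => i /eqP <-; rewrite ftau.
have d0 : d (tau i0) = c i0.
  rewrite /d (big_pred1 i0) // => i; apply/eqP/eqP => [/tau_inj|->] //.
suff /Smin : `[< spans (S :\ tau i0)%SET >].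
  by rewrite (cardsD1 (tau i0) S) tauS add1n ltnn.
apply/asboolP => v /sS[b Wb]; pose k := b (tau i0) / c i0.
exists (fun t => b t - k * d t).
have -> : \sum_(t in (S :\ tau i0)%SET) (b t - k * d t) *: f t
        = \sum_(t in S) (b t - k * d t) *: f t.
  rewrite [RHS](bigD1 (tau i0)) //= d0 divfK // subrr scale0r add0r.
  by apply: eq_bigl => t; rewrite finset.in_setD1 andbC.
have -> : v - \sum_(t in S) (b t - k * d t) *: f t =
    (v - \sum_(t in S) b t *: f t) + k *: \sum_i c i *: x i.
  rewrite dE scaler_sumr -addrA; congr (v + _).
  rewrite -[RHS]opprK opprD opprK -sumrB; congr (- _).
  by apply: eq_bigr => t _; rewrite scalerBl scalerA.
by apply: WD => //; apply: WZ.
Qed.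

Section RestrictScalars.
Variables (K : fieldType) (A : algType K) (X : lmodType A).

(** A copy of [X] on which the field [K] acts through the algebra [A], so that
    linear algebra over [K] applies to an [A]-module. *)
Definition restrict_scalars : Type := X.
HB.instance Definition _ := GRing.Zmodule.on restrict_scalars.

Definition rscale (k : K) (x : restrict_scalars) : restrict_scalars :=
  k%:A *: (x : X).

Lemma rscaleA a b v : rscale a (rscale b v) = rscale (a * b) v.
Proof. by rewrite /rscale scalerA -scalerAl mul1r scalerA. Qed.
Lemma rscale1 : left_id 1 rscale.
Proof. by move=> v; rewrite /rscale !scale1r. Qed.
Lemma rscaleDr : right_distributive rscale +%R.
Proof. by move=> a v w; rewrite /rscale scalerDr. Qed.
Lemma rscaleDl v : {morph rscale^~ v : a b / a + b}.
Proof. by move=> a b; rewrite /rscale scalerDl scalerDl. Qed.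

HB.instance Definition _ := GRing.Zmodule_isLmodule.Build K restrict_scalars
  rscaleA rscale1 rscaleDr rscaleDl.

End RestrictScalars.

(** * Paths in a quiver without cycles *)

Section AcyclicQuiver.
Variable Q : quiver.
Hypothesis acyc : no_directed_cycle Q.
Implicit Types (p q : qpath Q) (v w : vertex Q) (a : arrow Q).

Definition walk_path v s (w : is_walk v s) : qpath Q := exist _ (v, s) w.

Lemma path_nil q : plen q = 0%N -> q = vpath (psrc q).
Proof. by move=> q0; apply: qpath_eq => //; apply: size0nil. Qed.

Lemma no_return p q : psrc q = ptgt p -> ptgt q = psrc p ->
  plen p = 0%N /\ plen q = 0%N.
Proof.
move=> qp pq; have [r _ [r1 r2 r3]] := pcompP qp.
have := acyc (p := r); rewrite r1 r2 pq => /(_ erefl).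
by rewrite /plen r3 size_cat => /eqP; rewrite addn_eq0 => /andP[/eqP-> /eqP->].
Qed.

Lemma arrow_neq a : src a != tgt a.
Proof. by apply/eqP => sa; have := acyc (p := apath a) sa. Qed.

(** Between two visits of the same vertex a path would run through a cycle. *)
Lemma uniq_pverts p : uniq (pverts p).
Proof.
rewrite /pverts; have := valP p; rewrite /psrc /parr; move: (val p) => [v s] /=.
elim: s v => [|a s IH] v //= /andP[/eqP sv ws]; have /= -> := IH _ ws.
rewrite andbT in_cons negb_or -{1}sv (arrow_neq a) /=.
apply/negP => /mapP[b bs vb].
have [s1 [s2 sE]] : exists s1 s2, s = rcons s1 b ++ s2.
  by case/splitPr: bs => s1 s2; exists s1, s2; rewrite cat_rcons.
have ww : is_walk v (a :: rcons s1 b).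
  by move: ws; rewrite /= sv eqxx /= sE is_walk_cat => /andP[].
have := acyc (p := walk_path ww).
by rewrite /ptgt /walk_end /psrc /= map_rcons last_rcons => /(_ vb).
Qed.

Lemma index_walk_end p s1 s2 : parr p = s1 ++ s2 ->
  index (walk_end (psrc p) s1) (pverts p) = size s1.
Proof.
move=> pE; have -> : walk_end (psrc p) s1 = nth (psrc p) (pverts p) (size s1).
  rewrite /walk_end /pverts pE map_cat -cat_cons nth_cat /= size_map ltnSn.
  by rewrite (last_nth (psrc p)) size_map.
by rewrite index_uniq ?uniq_pverts // /pverts /= pE size_map size_cat ltnS leq_addr.
Qed.

End AcyclicQuiver.

Section PathVertices.
Variables (Q : quiver) (p : qpath Q).
Implicit Types (v : vertex Q) (a : arrow Q).

Definition init_arrows v := take (index v (pverts p)) (parr p).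
Definition final_arrows v := drop (index v (pverts p)) (parr p).

Lemma cat_init_final v : parr p = init_arrows v ++ final_arrows v.
Proof. by rewrite cat_take_drop. Qed.

Lemma walk_end_init v : v \in pverts p -> walk_end (psrc p) (init_arrows v) = v.
Proof.
move=> vp; rewrite -[RHS](nth_index (psrc p) vp) /walk_end /init_arrows.
set i := index _ _; have ip : (i <= size (parr p))%N.
  by have := vp; rewrite -index_mem /pverts /= size_map ltnS.
rewrite map_take (last_nth (psrc p)) size_takel ?size_map //.
by rewrite /pverts; case: i ip => //= i ip; rewrite nth_take.
Qed.

Lemma walk_init v : is_walk (psrc p) (init_arrows v).
Proof. by have := valP p; rewrite -/(parr p) (cat_init_final v) is_walk_cat => /andP[]. Qed.

Lemma walk_final v : v \in pverts p -> is_walk v (final_arrows v).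
Proof.
move=> vp; have := valP p.
by rewrite -/(parr p) (cat_init_final v) is_walk_cat walk_end_init // => /andP[].
Qed.

Lemma walk_end_final v : v \in pverts p -> walk_end v (final_arrows v) = ptgt p.
Proof. by move=> vp; rewrite /ptgt (cat_init_final v) walk_end_cat walk_end_init. Qed.

Lemma psrc_in : psrc p \in pverts p. Proof. exact: mem_head. Qed.

Lemma ptgt_in : ptgt p \in pverts p. Proof. exact: mem_last. Qed.

Lemma init_psrc : init_arrows (psrc p) = [::].
Proof. by rewrite /init_arrows /= eqxx take0. Qed.

Lemma final_psrc : final_arrows (psrc p) = parr p.
Proof. by rewrite /final_arrows /= eqxx drop0. Qed.

Lemma from_psrc v : v \in pverts p -> exists q, psrc q = psrc p /\ ptgt q = v.
Proof. by move=> vp; exists (walk_path (walk_init v)); split=> //; apply: walk_end_init. Qed.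

Lemma to_ptgt v : v \in pverts p -> exists q, psrc q = v /\ ptgt q = ptgt p.
Proof. by move=> vp; exists (walk_path (walk_final vp)); split=> //; apply: walk_end_final. Qed.

Hypothesis acyc : no_directed_cycle Q.

Lemma no_path_to_psrc v q : v \in pverts p -> psrc q = v -> ptgt q = psrc p ->
  plen q = 0%N.
Proof.
case/from_psrc=> r [r1 r2] qv qp.
by have [] := no_return acyc (etrans qv (esym r2)) (etrans qp (esym r1)).
Qed.

Lemma no_path_from_ptgt v q : v \in pverts p -> psrc q = ptgt p -> ptgt q = v ->
  plen q = 0%N.
Proof.
case/to_ptgt=> r [r1 r2] qv qp.
by have [] := no_return acyc (etrans r1 (esym qp)) (etrans r2 (esym qv)).
Qed.

Lemma init_ptgt : init_arrows (ptgt p) = parr p.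
Proof.
rewrite /init_arrows (index_walk_end acyc (s2 := [::])) ?cats0 //.
by rewrite take_size.
Qed.

Lemma path_arrow a : a \in parr p ->
  [/\ src a \in pverts p, tgt a \in pverts p,
      init_arrows (tgt a) = rcons (init_arrows (src a)) a
    & final_arrows (src a) = a :: final_arrows (tgt a)].
Proof.
case/splitPr pE : {-1}(parr p) / => [s1 s2].
have w1 : walk_end (psrc p) s1 = src a.
  by have := valP p; rewrite -/(parr p) pE is_walk_cat /= => /and3P[_ /eqP].
have w2 : walk_end (psrc p) (rcons s1 a) = tgt a.
  by rewrite /walk_end map_rcons last_rcons.
have i1 := index_walk_end acyc pE.
have i2 : index (tgt a) (pverts p) = (size s1).+1.
  by rewrite -w2 (index_walk_end acyc (s2 := s2)) ?size_rcons // cat_rcons.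
have ip : (size (pverts p) = (size s1 + size s2).+2)%N.
  by rewrite /pverts /= size_map pE size_cat addnS.
rewrite w1 in i1; rewrite /init_arrows /final_arrows i1 i2 pE; split.
- by rewrite -index_mem i1 ip ltnS -addnS leq_addr.
- by rewrite -index_mem i2 ip ltnS ltnS leq_addr.
- by rewrite take_cat ltnNge leqnSn /= subSnn take_size_cat //= take0 cats1.
- by rewrite drop_size_cat // drop_cat ltnNge leqnSn subSnn /= drop0.
Qed.

End PathVertices.

(** * Quotients of a path algebra *)

Section QuotientAlgebra.
Variables (K : fieldType) (Q : quiver) (A : algType K).
Variable pi : {lrmorphism path_algebra K Q -> A}.
Implicit Types (p q : qpath Q) (v w : vertex Q) (a : arrow Q) (x y : A).

Definition path_cls q : A := pi (pathelt K q).
Definition vertex_cls v : A := path_cls (vpath v).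
(** The image in [A] of the k-th power of the arrow ideal.  The first of these
    powers turns out to be the Jacobson radical, and the second one its square
    ([jacobsonE], [jacobson2E]). *)
Definition arrow_power k : set A := pi @` (@arrow_ideal_pow K Q k).

Local Notation pcl := path_cls.
Local Notation e := vertex_cls.
Local Notation Pow := arrow_power.
Local Notation cls := (arrow_cls pi).
Local Notation aprod := (arrow_prod pi).

Lemma path_clsM p q : psrc q = ptgt p ->
  exists r, [/\ pcl q * pcl p = pcl r, psrc r = psrc p, ptgt r = ptgt q
              & parr r = parr p ++ parr q].
Proof.
move=> qp; have [r rE [r1 r2 r3]] := pcompP qp; exists r; split=> //.
by rewrite /path_cls -rmorphM patheltM rE.
Qed.

Lemma path_clsM0 p q : psrc q != ptgt p -> pcl q * pcl p = 0.
Proof. by move=> qp; rewrite /path_cls -rmorphM patheltM pcompN //= raddf0. Qed.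

Lemma vertex_path v q : e v * pcl q = if v == ptgt q then pcl q else 0.
Proof.
rewrite /vertex_cls /path_cls -rmorphM patheltM pcomp_vl.
by case: ifP => //= _; rewrite raddf0.
Qed.

Lemma path_vertex v q : pcl q * e v = if v == psrc q then pcl q else 0.
Proof.
rewrite /vertex_cls /path_cls -rmorphM patheltM pcomp_vr.
by case: ifP => //= _; rewrite raddf0.
Qed.

Lemma vertexM v w : e v * e w = if v == w then e v else 0.
Proof.
by have := vertex_path v (vpath w); rewrite /ptgt /walk_end /psrc /= => ->; case: eqP => [->|].
Qed.

Lemma vertex_idem v : e v * e v = e v. Proof. by rewrite vertexM eqxx. Qed.

Lemma vertex_sum : \sum_v e v = 1.
Proof. by rewrite -(rmorph1 pi) /GRing.one /= /pa_one raddf_sum. Qed.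

Lemma arrow_clsE a : cls a = pcl (apath a). Proof. by []. Qed.

Lemma vertex_arrow v a : e v * cls a = if v == tgt a then cls a else 0.
Proof. exact: vertex_path. Qed.

Lemma arrow_vertex v a : cls a * e v = if v == src a then cls a else 0.
Proof. exact: path_vertex. Qed.

Lemma arrow_prod0 : aprod [::] = 1.
Proof. by rewrite /arrow_prod big_nil. Qed.

Lemma arrow_prod_cat s1 s2 : aprod (s1 ++ s2) = aprod s2 * aprod s1.
Proof. by rewrite /arrow_prod rev_cat big_cat. Qed.

Lemma arrow_prod1 a : aprod [:: a] = cls a.
Proof. by rewrite /arrow_prod big_seq1. Qed.

Lemma arrow_prod_cons a s : aprod (a :: s) = aprod s * cls a.
Proof. by rewrite -cat1s arrow_prod_cat arrow_prod1. Qed.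

Lemma arrow_prod_rcons a s : aprod (rcons s a) = cls a * aprod s.
Proof. by rewrite -cats1 arrow_prod_cat arrow_prod1. Qed.

Lemma path_cls_walk v s (w : is_walk v s) : pcl (walk_path w) = aprod s * e v.
Proof.
elim: s v w => [|a s IH] v w.
  by rewrite arrow_prod0 mul1r; congr path_cls; apply: qpath_eq.
have /andP[/eqP sv ws] := w.
have [r [rE r1 r2 r3]] := path_clsM (erefl : psrc (walk_path ws) = ptgt (apath a)).
have -> : walk_path w = r by apply: qpath_eq; rewrite ?r1 ?r3.
rewrite -rE IH -arrow_clsE -mulrA vertex_arrow eqxx arrow_prod_cons -!mulrA.
by rewrite arrow_vertex -sv eqxx.
Qed.

Lemma path_clsE q : pcl q = aprod (parr q) * e (psrc q).
Proof.
rewrite -(path_cls_walk (valP q : is_walk (psrc q) (parr q))).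
by congr path_cls; apply: qpath_eq.
Qed.

Lemma vertex_walk v s : is_walk v s -> aprod s * e v = e (walk_end v s) * (aprod s * e v).
Proof. by move=> w; rewrite -(path_cls_walk w) vertex_path eqxx. Qed.

(** Splitting off the arrow that is passed first; this is what makes inductions
    on the length of a path possible. *)
Lemma path_cls_arrow q : (0 < plen q)%N -> exists a q',
  [/\ psrc q' = tgt a, src a = psrc q, plen q = (plen q').+1, ptgt q' = ptgt q
    & pcl q = pcl q' * cls a].
Proof.
rewrite /plen; case qE: (parr q) => [//|a s] _.
have := valP q; rewrite -/(parr q) qE /= => /andP[/eqP sa ws].
have [r [rE r1 r2 r3]] := path_clsM (erefl : psrc (walk_path ws) = ptgt (apath a)).
have -> : q = r by apply: qpath_eq; rewrite ?r1 ?r3 ?qE.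
by exists a, (walk_path ws); split; rewrite ?rE ?r2 ?r1.
Qed.

Lemma arrow_powerD k x y : Pow k x -> Pow k y -> Pow k (x + y).
Proof.
case=> a Pa <- [b Pb <-]; exists (a + b); last by rewrite raddfD.
move=> q /(fsubsetP (msuppD_le _ _)); rewrite in_fsetU => /orP[/Pa|/Pb] //.
Qed.

Lemma arrow_powerZ k c x : Pow k x -> Pow k (c *: x).
Proof.
case=> a Pa <-; exists (c *: a); last by rewrite linearZ.
by move=> q /(fsubsetP (msuppZ_le _ _)) /Pa.
Qed.

Lemma arrow_power0 k : Pow k 0.
Proof. by exists 0; [move=> q; rewrite msupp0 | rewrite raddf0]. Qed.

Lemma arrow_powerB k x y : Pow k x -> Pow k y -> Pow k (x - y).
Proof. by move=> Px Py; apply: arrow_powerD => //; rewrite -scaleN1r; apply: arrow_powerZ. Qed.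

Lemma arrow_power_path k q : (k <= plen q)%N -> Pow k (pcl q).
Proof.
move=> kq; exists (pathelt K q) => // r.
by rewrite -mcoeff_neq0 pathelt_coef; have [<- //|_] := eqVneq q r; rewrite eqxx.
Qed.

(** Additive and K-homogeneous statements about the elements of a power of the
    arrow ideal need to be checked on paths only. *)
Lemma arrow_power_ind k (S : set A) :
  S 0 -> (forall x y, S x -> S y -> S (x + y)) -> (forall c x, S x -> S (c *: x)) ->
  (forall q, (k <= plen q)%N -> S (pcl q)) -> forall x, Pow k x -> S x.
Proof.
move=> S0 SD SZ Sq _ [a Pa <-]; rewrite (pathelt_sum a) raddf_sum /=.
rewrite big_seq_cond; apply: big_ind => // q; rewrite andbT => /Pa kq.
by rewrite linearZ; apply: SZ; apply: Sq.
Qed.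

Lemma arrow_powerS k l x : (l <= k)%N -> Pow k x -> Pow l x.
Proof.
move=> lk; apply: arrow_power_ind; first exact: arrow_power0.
- by move=> ? ? ? ?; apply: arrow_powerD.
- by move=> ? ? ?; apply: arrow_powerZ.
- by move=> q kq; apply: arrow_power_path; apply: leq_trans kq.
Qed.

Lemma arrow_powerM k l x y : Pow k x -> Pow l y -> Pow (k + l) (x * y).
Proof.
move=> Px Py; move: x Px; apply: arrow_power_ind.
- by rewrite mul0r; apply: arrow_power0.
- by move=> ? ? ? ?; rewrite mulrDl; apply: arrow_powerD.
- by move=> ? ? ?; rewrite -scalerAl; apply: arrow_powerZ.
move=> q kq; move: y Py; apply: arrow_power_ind.
- by rewrite mulr0; apply: arrow_power0.
- by move=> ? ? ? ?; rewrite mulrDr; apply: arrow_powerD.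
- by move=> ? ? ?; rewrite -scalerAr; apply: arrow_powerZ.
move=> r lr; have [qr|qr] := eqVneq (psrc q) (ptgt r); last first.
  by rewrite path_clsM0 //; apply: arrow_power0.
have [s [-> _ _ sE]] := path_clsM qr; apply: arrow_power_path.
by rewrite /plen sE size_cat addnC leq_add.
Qed.

Section Quotient.
Variable I : set (path_algebra K Q).
Hypothesis quot : is_quotient_map pi I.

Lemma arrow_power0T x : Pow 0 x.
Proof. by have [a <-] := quot.1 x; exists a. Qed.

Lemma arrow_powerMl k x y : Pow k y -> Pow k (x * y).
Proof. exact: arrow_powerM (arrow_power0T x). Qed.

Lemma arrow_powerMr k x y : Pow k x -> Pow k (x * y).
Proof. by move=> Px; rewrite -[k]addn0; apply: arrow_powerM Px (arrow_power0T y). Qed.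

(** Scalars, vertices and arrows generate [A] as a ring.  This reduces closure of
    a subset under [A] and linearity over [A] to vertices and arrows
    ([submod_gen], [linear_gen]). *)
Lemma algebra_ind (S : set A) :
  (forall c : K, S c%:A) -> (forall x y, S x -> S y -> S (x + y)) ->
  (forall x y, S x -> S y -> S (x * y)) -> (forall v, S (e v)) ->
  (forall a, S (cls a)) -> forall x, S x.
Proof.
move=> Sc SD SM Sv Sa x; have := arrow_power0T x; apply: arrow_power_ind => //.
- by have := Sc 0; rewrite scale0r.
- by move=> c y Sy; rewrite -[y]mul1r scalerAl; apply: SM.
move=> q _; rewrite path_clsE; apply: (SM _ _ _ (Sv _)).
elim: (parr q) => [|a s IH]; first by rewrite arrow_prod0 -[1]scale1r.
by rewrite arrow_prod_cons; apply: (SM _ _ IH).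
Qed.

(** The paths that occur in [x] have length at least [k], and [e v * x * e w]
    retains only those that run from [w] to [v]. *)
Lemma corner0 k v w x : Pow k x ->
  (forall q, psrc q = w -> ptgt q = v -> (plen q < k)%N) -> e v * x * e w = 0.
Proof.
move=> Px noq; move: x Px; apply: arrow_power_ind.
- by rewrite mulr0 mul0r.
- by move=> x y xE yE; rewrite mulrDr mulrDl xE yE addr0.
- by move=> c x xE; rewrite -scalerAr -scalerAl xE scaler0.
move=> q kq; rewrite vertex_path; case: eqP => [vq|]; last by rewrite mul0r.
rewrite path_vertex; case: eqP => // wq.
by have := noq q (esym wq) (esym vq); rewrite ltnNge kq.
Qed.

(** Modulo the arrow ideal, only the trivial path at [v] survives the product
    with [e v]. *)
Lemma local_decomp v x : exists c j, Pow 1 j /\ x * e v = c *: e v + j.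
Proof.
have := arrow_power0T x; move: x; apply: arrow_power_ind.
- by exists 0, 0; rewrite mul0r scale0r addr0; split=> //; apply: arrow_power0.
- move=> x y [c [j [Pj xE]]] [d [l [Pl yE]]]; exists (c + d), (j + l).
  by rewrite mulrDl xE yE scalerDl addrACA; split=> //; apply: arrow_powerD.
- move=> d x [c [j [Pj xE]]]; exists (d * c), (d *: j).
  by rewrite -scalerAl xE scalerDr scalerA; split=> //; apply: arrow_powerZ.
move=> q _; have [q0|q0] := posnP (plen q).
  have -> : pcl q = e (psrc q) by rewrite {1}(path_nil q0).
  rewrite vertexM; case: eqP => [->|_].
    by exists 1, 0; rewrite scale1r addr0; split=> //; apply: arrow_power0.
  by exists 0, 0; rewrite scale0r addr0; split=> //; apply: arrow_power0.
exists 0, (pcl q * e v); rewrite scale0r add0r; split=> //.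
by apply/arrow_powerMr/arrow_power_path.
Qed.

Lemma offdiag v w x : v != w -> Pow 1 (e v * x * e w).
Proof.
move=> vw; have [c [j [Pj xE]]] := local_decomp w x.
rewrite -mulrA xE mulrDr -scalerAr vertexM (negbTE vw) scaler0 add0r.
exact: arrow_powerMl.
Qed.

Section Modules.
Variable M : lmodType A.
Implicit Types (N L : set M) (z : M).

Lemma vertex_decomp z : z = \sum_v e v *: z.
Proof. by rewrite -scaler_suml vertex_sum scale1r. Qed.

Lemma submod_gen N : N 0 -> (forall z z', N z -> N z' -> N (z + z')) ->
  (forall (c : K) z, N z -> N (c%:A *: z)) -> (forall v z, N z -> N (e v *: z)) ->
  (forall a z, N z -> N (cls a *: z)) -> is_submod N.
Proof.
move=> N0 ND NZ Nv Na; apply/is_submodP; split=> //.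
move=> x; apply: (algebra_ind (S := [set x | forall z, N z -> N (x *: z)])) => //=.
- by move=> y y' Ny Ny' z Nz; rewrite scalerDl; apply: ND; [apply: Ny|apply: Ny'].
- by move=> y y' Ny Ny' z Nz; rewrite -scalerA; apply/Ny/Ny'.
Qed.

Lemma scaleAK (c : K) x z : c%:A *: (x *: z) = (c *: x) *: z.
Proof. by rewrite scalerA -scalerAl mul1r. Qed.

Lemma scaleAC (c : K) x z : c%:A *: (x *: z) = x *: (c%:A *: z).
Proof. by rewrite !scalerA -scalerAl mul1r -scalerAr mulr1. Qed.

End Modules.

Lemma linear_gen (M N : lmodType A) (f : M -> N) :
  (forall z z', f (z + z') = f z + f z') ->
  (forall (c : K) z, f (c%:A *: z) = c%:A *: f z) ->
  (forall v z, f (e v *: z) = e v *: f z) ->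
  (forall a z, f (cls a *: z) = cls a *: f z) ->
  exists g : {linear M -> N}, g =1 f.
Proof.
move=> fD fK fv fa; apply: linear_of => x z z'; rewrite fD; congr (_ + _).
move: x z; apply: (algebra_ind (S := [set x | forall z, f (x *: z) = x *: f z])) => //=.
- by move=> x x' fx fx' z; rewrite !scalerDl fD fx fx'.
- by move=> x x' fx fx' z; rewrite -!scalerA fx fx'.
Qed.

End Quotient.
End QuotientAlgebra.

(** * Simple modules, composition series and the radical *)

Section SimpleFactors.
Variables (K : fieldType) (Q : quiver) (A : algType K).
Variable pi : {lrmorphism path_algebra K Q -> A}.
Variable I : set (path_algebra K Q).
Hypothesis adm : admissible I.
Hypothesis quot : is_quotient_map pi I.
Implicit Types (p q : qpath Q) (v w : vertex Q) (a : arrow Q).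

Local Notation pcl := (path_cls pi).
Local Notation e := (vertex_cls pi).
Local Notation Pow := (arrow_power pi).
Local Notation cls := (arrow_cls pi).

Lemma long_path0 : exists m, forall q, (m <= plen q)%N -> pcl q = 0.
Proof.
have [_ [m _ [Im _]]] := adm; exists m => q mq; apply/quot.2/Im => r.
rewrite -monalg.mcoeff_neq0 pathelt_coef.
by have [<- //|_] := eqVneq q r; rewrite eqxx.
Qed.

Section Modules.
Variable M : lmodType A.
Implicit Types (L N : set M) (x z : M).

(** Take an element outside [L] and apply to it a path of the largest length for
    which the result [z] is still outside [L].  All arrows then send [z] into [L],
    so [L + K z] is a submodule and must be all of [N].  In particular [N / L] is
    a line at the end point of that path, and it is annihilated by arrows. *)
Lemma simple_factorP L N : simple_factor L N -> exists v z,
  [/\ N z, ~ L z, e v *: z = z, forall a x, N x -> L (cls a *: x)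
    & forall x, N x -> exists c : K, L (x - c%:A *: z)].
Proof.
move=> sLN; have [sL sN LN neLN _] := sLN.
have /is_submodP[L0 LD LZ] := sL; have /is_submodP[N0 ND NZ] := sN.
have [z1 Nz1 Lz1] : exists2 z1, N z1 & ~ L z1.
  apply/not_exists2P => h; apply: neLN; apply/seteqP; split=> // x Nx.
  by case: (h x) => // /contrapT.
pose killed k := `[< forall q, (k <= plen q)%N -> L (pcl q *: z1) >].
have exk : exists k, killed k.
  have [m hm] := long_path0; exists m; apply/asboolP => q mq.
  by rewrite hm // scale0r.
case: (ex_minnP exk) => k /asboolP kk kmin.
have k0 : (0 < k)%N.
  rewrite lt0n; apply/eqP => k0; apply: Lz1; rewrite (vertex_decomp pi z1).
  by apply: submod_sum => // v _; apply: kk; rewrite k0.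
have [q qk Lq] : exists2 q, (k.-1 <= plen q)%N & ~ L (pcl q *: z1).
  apply/not_exists2P => h; suff : (k <= k.-1)%N by rewrite -ltnS prednK // ltnn.
  by apply: kmin; apply/asboolP => q kq; case: (h q) => // /contrapT.
pose z := pcl q *: z1; pose v := ptgt q.
have Nz : N z by apply: NZ.
have vz : e v *: z = z by rewrite scalerA vertex_path eqxx.
have az a : L (cls a *: z).
  rewrite scalerA arrow_clsE.
  have [aq|aq] := eqVneq (psrc (apath a)) (ptgt q); last by rewrite path_clsM0 // scale0r.
  have [r [-> _ _ rE]] := path_clsM pi aq; apply: kk.
  by rewrite /plen rE size_cat /= addn1 -(prednK k0) ltnS.
exists v, z.
pose T : set M := [set x | exists c : K, L (x - c%:A *: z)].
have TN : T = N.
  apply: (simple_factor_eqT sLN) Lq; last 1 first.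
  - by exists 1; rewrite scale1r -/z scale1r subrr.
  - apply: (submod_gen quot).
    + by exists 0; rewrite !scale0r subr0.
    + move=> x y [c Lx] [d Ly]; exists (c + d); rewrite !scalerDl opprD addrACA.
      exact: LD.
    + move=> c x [d Lx]; exists (c * d).
      by rewrite -scalerA -(scaleAK c d%:A) -scalerBr; apply: LZ.
    + move=> w x [d Lx]; exists (if w == v then d else 0).
      have -> : (if w == v then d else 0)%:A *: z = e w *: (d%:A *: z).
        rewrite -scaleAC -{2}vz scalerA vertexM.
        by case: eqP => [->|_]; rewrite ?vz // !scale0r scaler0.
      by rewrite -scalerBr; apply: LZ.
    + move=> a x [d Lx]; exists 0; rewrite !scale0r subr0.
      have -> : cls a *: x = cls a *: (x - d%:A *: z) + d%:A *: (cls a *: z).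
        by rewrite scalerBr scaleAC subrK.
      by apply: LD; apply: LZ.
  - by move=> x Lx; exists 0; rewrite !scale0r subr0.
  - move=> x [c Lx]; rewrite -[x](subrK (c%:A *: z)); apply: ND; first exact: LN.
    exact: NZ.
split=> //; rewrite -TN // => a x [c Lx].
have -> : cls a *: x = cls a *: (x - c%:A *: z) + c%:A *: (cls a *: z).
  by rewrite scalerBr scaleAC subrK.
by apply: LD; apply: LZ.
Qed.

(** Each factor of the series is a line at one vertex, so it accounts for at most
    one of the vertices in [s].  If the vertices of [s] exhaust the series, every
    factor belongs to one of them, which leaves nothing at the other vertices and
    one dimension at each of these. *)
Lemma comp_chain_count c L N (s : seq (vertex Q)) (z : vertex Q -> M) :
  comp_chain L c N -> uniq s ->
  (forall v, v \in s -> [/\ N (z v), ~ L (z v) & e v *: z v = z v]) ->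
  (size s <= size c)%N /\
  (size s = size c -> forall v x, N x -> e v *: x = x ->
     if v \in s then exists k : K, L (x - k%:A *: z v) else L x).
Proof.
elim: c L s => [|P' c IH] L s /=.
  move=> <-; case: s => [|w s] _ zs; first by split=> // _ v x Lx _.
  by have [] := zs w (mem_head _ _).
case=> sLP cPN us zs.
have [v0 [z0 [Pz0 Lz0 vz0 Pa Pz]]] := simple_factorP sLP.
have [/is_submodP[L0 LD LZ] sP _ _ _] := sLP.
(* The step from [L] to [P'] adds nothing away from [v0], and a line at [v0]. *)
have off v x : v != v0 -> P' x -> e v *: x = x -> L x.
  move=> vv0 Px vx; have [k Lx] := Pz x Px.
  have := LZ (e v) _ Lx; rewrite scalerBr vx -scaleAC -vz0 (scalerA (e v)) vertexM.
  by rewrite (negbTE vv0) scale0r scaler0 subr0.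
have on x y : P' x -> P' y -> ~ L y -> exists k : K, L (x - k%:A *: y).
  move=> Px Py Ly; have [k Lx] := Pz x Px; have [d Ly'] := Pz y Py.
  have d0 : d != 0.
    by apply/eqP => d0; apply: Ly; move: Ly'; rewrite d0 !scale0r subr0.
  exists (k / d); have -> : x - (k / d)%:A *: y =
      (x - k%:A *: z0) + (- (k / d))%:A *: (y - d%:A *: z0).
    rewrite scalerBr scalerA -scalerAl mul1r scalerA mulNr divfK // !scaleNr.
    by rewrite opprK addrACA addNr addr0.
  by apply: LD => //; apply: LZ.
pose s' := rem v0 s.
have us' : uniq s' by apply: rem_uniq.
have s'E v : (v \in s') = (v != v0) && (v \in s) by rewrite mem_rem_uniq.
have [|s'c s'E'] := IH P' s' cPN us'.
  move=> v; rewrite s'E => /andP[vv0 /zs[Nz Lz vz]]; split=> // Pv.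
  by apply: Lz; apply: off vz.
have ss' : (size s <= (size s').+1)%N.
  rewrite /s'; have [v0s|v0s] := boolP (v0 \in s); last by rewrite rem_id.
  by rewrite size_rem // leqSpred.
split; first exact: leq_trans ss' _.
move=> sc v x Nx vx.
have v0s : v0 \in s.
  by apply: contraT => v0s; move: s'c; rewrite /s' rem_id // sc ltnn.
have {s'E'} := s'E' _ v x Nx vx; rewrite size_rem // sc => /(_ erefl); rewrite s'E.
have [->|vv0] /= := eqVneq v v0.
  move=> Px; rewrite v0s; have [Nz Lz vz] := zs v0 v0s; apply: on => //.
  have := IH P' s' cPN us'; case.
    move=> w; rewrite s'E => /andP[ww0 /zs[Nw Lw vw]]; split=> // Pw.
    by apply: Lw; apply: off vw.
  move=> _ /(_ _ v0 (z v0) Nz vz); rewrite size_rem // sc => /(_ erefl).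
  by rewrite s'E eqxx.
case: ifP => [vs [k Pk]|_ Px]; last exact: off vx.
exists k; apply: (off v) => //; have [_ _ vz] := zs v vs.
by rewrite scalerBr vx -scaleAC vz.
Qed.

End Modules.

(** A maximal left ideal has a simple quotient, which arrows annihilate
    ([simple_factorP]); hence it contains the arrow ideal.  Conversely, for each
    vertex [v] the elements [y] with [y e_v] in the arrow ideal form a maximal left
    ideal: by [local_decomp] it has codimension one, and it is proper since
    relations of an admissible ideal only involve paths of length at least 2. *)
Lemma jacobsonE : jacobson A = Pow 1.
Proof.
apply/seteqP; split=> x.
  move=> Jx; rewrite -[x]mulr1 -(vertex_sum pi) mulr_sumr.
  apply: big_ind; [exact: arrow_power0|by move=> ? ? ? ?; apply: arrow_powerD|].
  move=> v _; pose m : set A^o := [set y : A | Pow 1 (y * e v)].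
  apply: (Jx m); split; last 1 first.
  - move=> N sN mN _; have [Nm|Nm] := pselect (N `<=` m); first by left; apply/seteqP.
    right; apply/seteqP; split=> // y _.
    have [y0 Ny0 my0] : exists2 y0, N y0 & ~ m y0.
      apply/not_exists2P => h; apply: Nm => z Nz.
      by case: (h z) => // /contrapT.
    have [c [j [Pj yE]]] := local_decomp quot v y.
    have [d [l [Pl y0E]]] := local_decomp quot v y0.
    have d0 : d != 0.
      by apply/eqP => d0; apply: my0; rewrite /m /= y0E d0 scale0r add0r.
    rewrite -[y](subrK ((c / d)%:A *: y0)).
    have /is_submodP[_ ND NZ] := sN; apply: (ND) (NZ _ _ Ny0); apply: mN.
    rewrite /m /= mulrBl -[(c / d)%:A *: y0]/((c / d)%:A * y0) -!scalerAl mul1r.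
    rewrite yE y0E scalerDr scalerA divfK // opprD addrACA subrr add0r.
    by apply: arrow_powerB => //; apply: arrow_powerZ.
  - apply/is_submodP; split; rewrite /m /=.
    + by rewrite mul0r; apply: arrow_power0.
    + by move=> y z Py Pz; rewrite mulrDl; apply: arrow_powerD.
    + by move=> y z Pz; rewrite -[y *: z]/(y * z) -mulrA; apply: (arrow_powerMl quot).
  - exact: submod_setT.
  - by [].
  - move=> mT; have : m (1 : A) by rewrite mT.
    rewrite /m /= mul1r => -[b Pb bE].
    have [_ [n _ [_ I2]]] := adm.
    have /I2/(_ (vpath v)) : I (b - pathelt K (vpath v)).
      by apply/quot.2; rewrite raddfB /= bE subrr.
    have bv : monalg.mcoeff (vpath v) b = 0.
      by apply/eqP; rewrite monalg.mcoeff_eq0; apply/negP => /Pb.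
    rewrite -monalg.mcoeff_neq0 mcoeffB bv pathelt_coef eqxx sub0r oppr_eq0 oner_eq0.
    by move/(_ isT).
move=> Px m sm; move: x Px.
have [/is_submodP[m0 mD mZ] _ _ _ _] := sm; have [_ [_ [_ _ _ ma _]]] := simple_factorP sm.
apply: arrow_power_ind => // [c x mx|q q0].
  have -> : c *: x = c%:A * x by rewrite -scalerAl mul1r.
  exact: mZ.
have [a [q' [_ _ _ _ ->]]] := path_cls_arrow pi q0.
by apply: mZ; have := ma a 1 Logic.I; rewrite -[_ *: _]/(_ * _) mulr1.
Qed.

Lemma jacobson2E : jacobson2 A = Pow 2.
Proof.
apply/seteqP; split=> x.
  apply.
    apply/is_submodP; split; [exact: arrow_power0|by move=> ? ? ? ?; apply: arrow_powerD|].
    by move=> a y; apply: (arrow_powerMl quot).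
  rewrite jacobsonE => _ [y Py [z Pz <-]]; exact: (@arrow_powerM _ _ _ pi 1 1).
move=> Px N sN JN; move: x Px; have /is_submodP[N0 ND NZ] := sN.
apply: arrow_power_ind => // [c x Nx|q q2].
  have -> : c *: x = c%:A * x by rewrite -scalerAl mul1r.
  exact: NZ.
have [a [q' [_ _ qq' _ ->]]] := path_cls_arrow pi (ltnW q2).
apply: JN; exists (pcl q').
  by rewrite jacobsonE; apply: arrow_power_path; rewrite qq' ltnS in q2.
by exists (cls a); rewrite // jacobsonE; apply: (@arrow_power_path _ _ _ _ 1 (apath a)).
Qed.

End SimpleFactors.

(** * Initial and final parts of the mast *)

Section MastProducts.
Variables (K : fieldType) (Q : quiver) (A : algType K).
Variable pi : {lrmorphism path_algebra K Q -> A}.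
Variable p : qpath Q.
Implicit Types (v w : vertex Q) (a : arrow Q).

Local Notation pcl := (path_cls pi).
Local Notation e := (vertex_cls pi).
Local Notation cls := (arrow_cls pi).
Local Notation upto := (path_upto pi p).
Local Notation from := (path_from pi p).

Lemma upto_psrc : upto (psrc p) = 1.
Proof. by rewrite /path_upto -/(init_arrows p _) init_psrc arrow_prod0. Qed.

Lemma from_psrc_vertex : from (psrc p) * e (psrc p) = pcl p.
Proof. by rewrite /path_from -/(final_arrows p _) final_psrc -path_clsE. Qed.

Lemma vertex_upto v : v \in pverts p ->
  e v * (upto v * e (psrc p)) = upto v * e (psrc p).
Proof. by move=> vp; rewrite [RHS]vertex_walk ?walk_init // walk_end_init. Qed.

Lemma vertex_from v : v \in pverts p -> e (ptgt p) * (from v * e v) = from v * e v.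
Proof. by move=> vp; rewrite [RHS]vertex_walk ?walk_final // walk_end_final. Qed.

Lemma from_upto v : from v * upto v = from (psrc p).
Proof.
rewrite /path_upto /path_from -/(final_arrows p _) -arrow_prod_cat.
by rewrite -/(init_arrows p _) -cat_init_final -/(final_arrows p _) final_psrc.
Qed.

Lemma vertex_mast_path : e (ptgt p) * pcl p = pcl p.
Proof. by rewrite vertex_path eqxx. Qed.

Lemma mast_path_vertex : pcl p * e (psrc p) = pcl p.
Proof. by rewrite path_vertex eqxx. Qed.

Lemma from_upto_vertex v : from v * (upto v * e (psrc p)) = pcl p.
Proof. by rewrite mulrA from_upto from_psrc_vertex. Qed.

Lemma from_vertex v : v \in pverts p -> v != ptgt p -> from v * e v = from v.
Proof.
move=> vp vn; have := walk_final vp; have := walk_end_final vp.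
rewrite /path_from -/(final_arrows p _); case: (final_arrows p v) => [|a s].
  by move=> vE; rewrite -vE eqxx in vn.
by move=> _ /andP[/eqP <- _]; rewrite arrow_prod_cons -mulrA arrow_vertex eqxx.
Qed.

Lemma upto_vertex v : v \in pverts p -> v != psrc p -> upto v * e (psrc p) = upto v.
Proof.
move=> vp vn; have := walk_init p v; have := walk_end_init vp.
rewrite /path_upto -/(init_arrows p _); case: (init_arrows p v) => [|a s].
  by move=> vE; rewrite -vE eqxx in vn.
by move=> _ /andP[/eqP <- _]; rewrite arrow_prod_cons -mulrA arrow_vertex eqxx.
Qed.

Lemma cls_upto_vertex a : src a \in pverts p ->
  cls a * upto (src a) * e (psrc p) = cls a * upto (src a).
Proof.
move=> sp; have [s1|s1] := eqVneq (src a) (psrc p); last by rewrite -mulrA upto_vertex.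
by rewrite s1 upto_psrc mulr1 arrow_vertex s1 eqxx.
Qed.

Hypothesis acyc : no_directed_cycle Q.

Lemma upto_ptgt : upto (ptgt p) * e (psrc p) = pcl p.
Proof. by rewrite /path_upto -/(init_arrows p _) init_ptgt // -path_clsE. Qed.

Lemma upto_arrow a : a \in parr p -> upto (tgt a) = cls a * upto (src a).
Proof.
by move=> /(path_arrow acyc)[_ _ h _]; rewrite /path_upto -/(init_arrows p _) h arrow_prod_rcons.
Qed.

Lemma from_arrow a : a \in parr p -> from (src a) = from (tgt a) * cls a.
Proof.
by move=> /(path_arrow acyc)[_ _ _ h]; rewrite /path_from -/(final_arrows p _) h arrow_prod_cons.
Qed.

(** The final part of [p] from [v] on, including the trivial path when [v] is the
    end of [p], where [path_from] is 1; it is 0 at vertices off the mast. *)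
Definition tail v : A := if v \in pverts p then from v * e v else 0.

Lemma vertex_tail v : e (ptgt p) * tail v = tail v.
Proof. by rewrite /tail; case: ifP => [/vertex_from //|_]; rewrite mulr0. Qed.

Lemma tail_vertex v w : tail v * e w = if w == v then tail v else 0.
Proof.
rewrite /tail; case: ifP => _; last by rewrite mul0r; case: ifP.
by rewrite -mulrA vertexM eq_sym; case: eqP => _; rewrite ?mulr0.
Qed.

Lemma tail_cls a : tgt a \in pverts p -> tail (tgt a) * cls a = from (tgt a) * cls a.
Proof. by move=> ap; rewrite /tail ap -mulrA vertex_arrow eqxx. Qed.

Lemma tail_psrc : tail (psrc p) = pcl p.
Proof. by rewrite /tail psrc_in from_psrc_vertex. Qed.

End MastProducts.

Lemma mem_take_pverts Q (p : qpath Q) v : no_directed_cycle Q ->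
  (v \in take (plen p) (pverts p)) = (v \in pverts p) && (v != ptgt p).
Proof.
move=> acyc; have := uniq_pverts acyc p; have := lastI (psrc p) [seq tgt a | a <- parr p].
rewrite -/(pverts p) -/(walk_end _ _) -/(ptgt p) => ->.
rewrite -cats1 take_size_cat ?size_belast ?size_map // cats1 rcons_uniq mem_rcons in_cons.
move=> /andP[np _]; case: eqP => [->|] /=; first by rewrite (negbTE np).
by rewrite andbT.
Qed.

Lemma mem_behead_pverts Q (p : qpath Q) v : no_directed_cycle Q ->
  (v \in behead (pverts p)) = (v \in pverts p) && (v != psrc p).
Proof.
move=> acyc; have /= /andP[np _] := uniq_pverts acyc p.
rewrite in_cons; case: eqP => [->|] /=; first by rewrite (negbTE np).
by rewrite andbT.
Qed.

(** * Coordinates on the uniserial module *)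

Section MastModule.
Variables (K : fieldType) (Q : quiver) (A : algType K).
Variable pi : {lrmorphism path_algebra K Q -> A}.
Variable I : set (path_algebra K Q).
Hypothesis adm : admissible I.
Hypothesis quot : is_quotient_map pi I.
Hypothesis acyc : no_directed_cycle Q.
Variables (U : lmodType A) (p : qpath Q) (u : U).
Implicit Types (v w : vertex Q) (a : arrow Q) (x : U).

Local Notation pcl := (path_cls pi).
Local Notation e := (vertex_cls pi).
Local Notation Pow := (arrow_power pi).
Local Notation cls := (arrow_cls pi).
Local Notation upto := (path_upto pi p).
Local Notation from := (path_from pi p).
Local Notation tail := (tail pi p).

Hypothesis lenU : has_length [set: U] (plen p).+1.
Hypothesis vertex_u : e (psrc p) *: u = u.
Hypothesis mast_path_u : pcl p *: u != 0.

(** A generator of the line of [U] at [v]; the value 0 off the mast lets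
    sums and structure constants range over all vertices and arrows. *)
Definition mast_elt v : U := if v \in pverts p then upto v *: u else 0.
Local Notation m := mast_elt.

Lemma mast_eltE v : v \in pverts p -> m v = upto v *: u.
Proof. by rewrite /m => ->. Qed.

Lemma mast_eltN v : v \notin pverts p -> m v = 0.
Proof. by rewrite /m => /negbTE ->. Qed.

Lemma mast_psrc : m (psrc p) = u.
Proof. by rewrite mast_eltE ?psrc_in // upto_psrc scale1r. Qed.

Lemma mast_ptgt : m (ptgt p) = pcl p *: u.
Proof. by rewrite mast_eltE ?ptgt_in // -vertex_u scalerA upto_ptgt // vertex_u. Qed.

Lemma from_mast v : v \in pverts p -> from v *: m v = m (ptgt p).
Proof.
by move=> vp; rewrite mast_eltE // -{1}vertex_u !scalerA from_upto from_psrc_vertex mast_ptgt.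
Qed.

Lemma mast_neq0 v : v \in pverts p -> m v != 0.
Proof.
move=> vp; apply: contra_neq mast_path_u => m0.
by rewrite -mast_ptgt -(from_mast vp) m0 scaler0.
Qed.

Lemma vertex_mast w v : e w *: m v = if w == v then m v else 0.
Proof.
have [vp|vp] := boolP (v \in pverts p); last by rewrite mast_eltN // scaler0; case: ifP.
have -> : m v = e v *: m v.
  by rewrite mast_eltE // -vertex_u !scalerA vertex_upto.
by rewrite scalerA vertexM; case: eqP => [->|_] //; rewrite scale0r.
Qed.

(** The mast elements are as many as the composition factors of [U], so
    [comp_chain_count] applies with equality. *)
Lemma vertex_line v x : e v *: x = x -> exists k : K, x = k%:A *: m v.
Proof.
have [c cU cs] := lenU; move=> vx.
have [|_] := comp_chain_count adm quot (z := m) cU (uniq_pverts acyc p).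
  by move=> w wp; split=> //; [apply/eqP/mast_neq0 | rewrite vertex_mast eqxx].
rewrite cs /pverts /= size_map -/(plen p) => /(_ erefl v x Logic.I vx).
rewrite -/(pverts p); case: ifP => [_ [k /eqP]|_ ->].
  by rewrite subr_eq0 => /eqP ->; exists k.
by exists 0; rewrite !scale0r.
Qed.

Lemma scaleK_inj v (c d : K) : v \in pverts p -> c%:A *: m v = d%:A *: m v -> c = d.
Proof.
move=> vp /eqP; rewrite -subr_eq0 -scalerBl -scalerBl => /eqP cd.
have [//|ncd] := eqVneq c d; case/eqP: (mast_neq0 vp).
rewrite -[m v]scale1r -[1]scale1r -(mulVf (x := c - d)) ?subr_eq0 //.
by rewrite -(scalerA (c - d)^-1) -scaleAK cd scaler0.
Qed.

Lemma coord_ex v x : exists k : K, e v *: x = k%:A *: m v /\ (v \notin pverts p -> k = 0).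
Proof.
have [|k kE] := @vertex_line v (e v *: x); first by rewrite scalerA vertex_idem.
have [vp|vp] := boolP (v \in pverts p); first by exists k.
by exists 0; split=> //; rewrite kE mast_eltN // !scaler0.
Qed.

Definition coord v x : K := sval (cid (coord_ex v x)).

Lemma coordE v x : e v *: x = (coord v x)%:A *: m v.
Proof. by rewrite /coord; case: cid => k []. Qed.

Lemma coordN v x : v \notin pverts p -> coord v x = 0.
Proof. by rewrite /coord; case: cid => k [] /=. Qed.

Lemma coord_uniq v x (k : K) : v \in pverts p -> e v *: x = k%:A *: m v -> coord v x = k.
Proof. by move=> vp; rewrite coordE => /(scaleK_inj vp). Qed.

Lemma mast_decomp x : x = \sum_v (coord v x)%:A *: m v.
Proof. by rewrite {1}(vertex_decomp pi x); apply: eq_bigr => v _; rewrite coordE. Qed.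

Lemma coordD v x y : coord v (x + y) = coord v x + coord v y.
Proof.
have [vp|vp] := boolP (v \in pverts p); last by rewrite !coordN // addr0.
by apply: coord_uniq => //; rewrite scalerDr !coordE !scalerDl.
Qed.

Lemma coordZ v (c : K) x : coord v (c%:A *: x) = c * coord v x.
Proof.
have [vp|vp] := boolP (v \in pverts p); last by rewrite !coordN // mulr0.
by apply: coord_uniq => //; rewrite -scaleAC coordE scaleAK scalerA.
Qed.

Lemma coord0 v : coord v 0 = 0.
Proof. by have := coordZ v 0 0; rewrite scaler0 mul0r. Qed.

Lemma coord_vertex v w x : coord v (e w *: x) = if v == w then coord v x else 0.
Proof.
have [vp|vp] := boolP (v \in pverts p); last by rewrite !coordN //; case: ifP.
apply: coord_uniq => //; rewrite scalerA vertexM; case: eqP => _; first exact: coordE.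
by rewrite !scale0r.
Qed.

Lemma coord_mast v w : coord v (m w) = if (v == w) && (v \in pverts p) then 1 else 0.
Proof.
have [vp|vp] := boolP (v \in pverts p); last by rewrite !coordN // andbF.
apply: coord_uniq => //; rewrite vertex_mast andbT; case: eqP => [->|_].
  by rewrite !scale1r.
by rewrite !scale0r.
Qed.

(** The scalar by which the arrow [a] maps the line at its source to the line at
    its target: 1 on the mast, and 0 if one end is off the mast. *)
Definition struct a : K := coord (tgt a) (cls a *: m (src a)).

Lemma cls_mast a : cls a *: m (src a) = (struct a)%:A *: m (tgt a).
Proof. by rewrite -coordE scalerA vertex_arrow eqxx. Qed.

Lemma struct_uniq a (k : K) : tgt a \in pverts p ->
  cls a *: m (src a) = k%:A *: m (tgt a) -> struct a = k.
Proof. by move=> ap aE; apply: coord_uniq => //; rewrite scalerA vertex_arrow eqxx. Qed.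

Lemma struct_path a : a \in parr p -> struct a = 1.
Proof.
move=> ap; have [sp tp _ _] := path_arrow acyc ap.
by apply: struct_uniq => //; rewrite !mast_eltE // upto_arrow // !scale1r scalerA.
Qed.

Lemma struct_srcN a : src a \notin pverts p -> struct a = 0.
Proof. by move=> ap; rewrite /struct mast_eltN // scaler0 coord0. Qed.

Lemma struct_tgtN a : tgt a \notin pverts p -> struct a = 0.
Proof. exact: coordN. Qed.

Lemma coord_arrow a x : coord (tgt a) (cls a *: x) = struct a * coord (src a) x.
Proof.
have [tp|tp] := boolP (tgt a \in pverts p); last by rewrite coordN // struct_tgtN // mul0r.
apply: coord_uniq => //; rewrite scalerA vertex_arrow eqxx.
have -> : cls a *: x = cls a *: (e (src a) *: x) by rewrite scalerA arrow_vertex eqxx.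
by rewrite coordE -scaleAC cls_mast scaleAK scalerA mulrC.
Qed.

Lemma coord_arrow0 v a x : v != tgt a -> coord v (cls a *: x) = 0.
Proof.
move=> va; have [vp|vp] := boolP (v \in pverts p); last by rewrite coordN.
by apply: coord_uniq; rewrite // scalerA vertex_arrow (negbTE va) !scale0r.
Qed.

(** The final parts of the mast compute the coordinates, because each of them
    carries its line isomorphically to the socle. *)
Lemma tail_scale v x : tail v *: x = (coord v x)%:A *: m (ptgt p).
Proof.
have [vp|vp] := boolP (v \in pverts p); last by rewrite coordN // /tail (negbTE vp) !scale0r.
by rewrite /tail vp -scalerA coordE -scaleAC from_mast.
Qed.

Lemma mast_generates x : exists y : A, x = y *: u.
Proof.
exists (\sum_v if v \in pverts p then coord v x *: upto v else 0).
rewrite {1}(mast_decomp x) scaler_suml; apply: eq_bigr => v _.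
rewrite /m; case: ifP => _; last by rewrite scaler0 scale0r.
by rewrite scaleAK.
Qed.

Lemma eq_on_top (X : lmodType A) (f g : {linear U -> X}) : f u = g u -> f =1 g.
Proof. by move=> fg x; have [y ->] := mast_generates x; rewrite !linearZ /= fg. Qed.

(** As a representation of the quiver [U] consists of lines on which arrows act by
    the scalars [struct a].  A linear map from [U] is therefore a choice of images
    of the generators on which arrows act by the same scalars. *)
Lemma hom_from_mast (X : lmodType A) (y : vertex Q -> X) :
  (forall v, e v *: y v = y v) -> (forall v, v \notin pverts p -> y v = 0) ->
  (forall a, cls a *: y (src a) = (struct a)%:A *: y (tgt a)) ->
  exists f : {linear U -> X}, forall v, v \in pverts p -> f (m v) = y v.
Proof.
move=> yv yN ya; pose f x := \sum_v (coord v x)%:A *: y v.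
have [||||g gE] := @linear_gen _ _ _ _ _ quot U X f.
- by move=> x z; rewrite -big_split; apply: eq_bigr => v _; rewrite coordD !scalerDl.
- by move=> c x; rewrite scaler_sumr; apply: eq_bigr => v _; rewrite coordZ scaleAK scalerA.
- move=> w x; rewrite scaler_sumr; apply: eq_bigr => v _; rewrite coord_vertex -scaleAC.
  have [<-|vw] := eqVneq v w; first by rewrite yv.
  by rewrite -(yv v) (scalerA (e w)) vertexM eq_sym (negbTE vw) !scale0r scaler0.
- move=> a x; rewrite /f scaler_sumr [LHS](bigD1 (tgt a)) //= big1 ?addr0; last first.
    by move=> v va; rewrite coord_arrow0 // !scale0r.
  rewrite [RHS](bigD1 (src a)) //= big1 ?addr0; last first.
    move=> v va; rewrite -scaleAC -(yv v) (scalerA (cls a)) arrow_vertex (negbTE va).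
    by rewrite scale0r scaler0.
  by rewrite coord_arrow -scaleAC ya scaleAK scalerA mulrC.
exists g => v vp; rewrite gE /f (bigD1 v) //= big1 ?addr0; last first.
  by move=> w wv; rewrite coord_mast (negbTE wv) !scale0r.
by rewrite coord_mast eqxx vp !scale1r.
Qed.

(** Dually, a linear map to [U] is a family of coordinate functionals [xi v] that
    intertwine the arrows with the scalars [struct a]. *)
Lemma hom_to_mast (X : lmodType A) (xi : vertex Q -> X -> K) :
  (forall v (x y : X), xi v (x + y) = xi v x + xi v y) ->
  (forall v (c : K) (x : X), xi v (c%:A *: x) = c * xi v x) ->
  (forall v w (x : X), xi v (e w *: x) = if v == w then xi v x else 0) ->
  (forall a (x : X), tgt a \in pverts p -> xi (tgt a) (cls a *: x) = struct a * xi (src a) x) ->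
  exists f : {linear X -> U}, forall x : X, f x = \sum_v (xi v x)%:A *: m v.
Proof.
move=> xiD xiZ xiv xia; pose f (x : X) := \sum_v (xi v x)%:A *: m v.
have [||||g gE] := @linear_gen _ _ _ _ _ quot X U f; last by exists g.
- by move=> x z; rewrite -big_split; apply: eq_bigr => v _; rewrite xiD !scalerDl.
- by move=> c x; rewrite scaler_sumr; apply: eq_bigr => v _; rewrite xiZ scaleAK scalerA.
- move=> w x; rewrite scaler_sumr; apply: eq_bigr => v _; rewrite xiv -scaleAC vertex_mast.
  by rewrite eq_sym; case: eqP => _; rewrite ?scaler0 ?scale0r ?scale0r.
- move=> a x; rewrite /f scaler_sumr [LHS](bigD1 (tgt a)) //= big1 ?addr0; last first.
    move=> v va; have -> : cls a *: x = e (tgt a) *: (cls a *: x).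
      by rewrite scalerA vertex_arrow eqxx.
    by rewrite xiv (negbTE va) !scale0r.
  rewrite [RHS](bigD1 (src a)) //= big1 ?addr0; last first.
    move=> v va; rewrite -scaleAC.
    have -> : m v = e v *: m v by rewrite vertex_mast eqxx.
    by rewrite (scalerA (cls a)) arrow_vertex (negbTE va) scale0r scaler0.
  rewrite -scaleAC cls_mast scaleAK scalerA.
  have [tp|tp] := boolP (tgt a \in pverts p); last by rewrite mast_eltN // !scaler0.
  by rewrite xia // mulrC.
Qed.

Local Notation J := (jacobson A).
Local Notation JU := (smul J [set: U]).

Lemma arrow_in_J a : J (cls a).
Proof. rewrite (jacobsonE adm quot); exact: (@arrow_power_path _ _ _ _ 1 (apath a)). Qed.

(** An arrow from a vertex of the mast to its start would close a cycle. *)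
Lemma src_notin a : tgt a = psrc p -> src a \notin pverts p.
Proof.
by move=> ap; apply/negP => sp; have := no_path_to_psrc acyc sp (q := apath a) erefl ap.
Qed.

Lemma tgt_notin a : src a = ptgt p -> tgt a \notin pverts p.
Proof.
by move=> ap; apply/negP => tp; have := no_path_from_ptgt acyc tp (q := apath a) ap erefl.
Qed.

Lemma coord_psrc_arrow a x : coord (psrc p) (cls a *: x) = 0.
Proof.
have [ap|ap] := eqVneq (psrc p) (tgt a); last exact: coord_arrow0.
by rewrite ap coord_arrow struct_srcN ?mul0r // src_notin.
Qed.

Lemma coord_psrc_submod : is_submod [set x | coord (psrc p) x = 0].
Proof.
apply: (submod_gen quot) => /=.
- exact: coord0.
- by move=> x y x0 y0; rewrite coordD x0 y0 addr0.
- by move=> c x x0; rewrite coordZ x0 mulr0.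
- by move=> v x x0; rewrite coord_vertex x0; case: ifP.
- by move=> a x _; apply: coord_psrc_arrow.
Qed.

(** No arrow between vertices of the mast ends in its start, so the elements with
    zero top coordinate form a submodule that contains the image of every arrow. *)
Lemma JU_coord x : JU x -> coord (psrc p) x = 0.
Proof.
move=> /(_ _ coord_psrc_submod); apply=> _ [j Jj [y _ <-]] /=.
move: Jj; rewrite (jacobsonE adm quot); move: j.
have /is_submodP[S0 SD SZ] := coord_psrc_submod.
apply: arrow_power_ind => [|j j' jy j'y|c j jy|q q0].
- by rewrite scale0r coord0.
- by rewrite scalerDl coordD jy j'y addr0.
- by rewrite -scaleAK coordZ jy mulr0.
have [a [q' [_ _ _ _ ->]]] := path_cls_arrow pi q0.
by rewrite -scalerA; apply: SZ; apply: coord_psrc_arrow.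
Qed.

Lemma mast_path_coord x : pcl p *: x = (coord (psrc p) x)%:A *: m (ptgt p).
Proof. by rewrite -tail_scale tail_psrc. Qed.

Lemma vertex_walk_power v s : is_walk v s -> Pow (size s) (arrow_prod pi s * e v).
Proof. by move=> w; rewrite -(path_cls_walk pi w); apply: arrow_power_path. Qed.

Lemma JU_mast v : v \in pverts p -> v != psrc p -> JU (m v).
Proof.
move=> vp v1; apply: sub_submod_span; exists (upto v).
  rewrite (jacobsonE adm quot) -upto_vertex //.
  apply: arrow_powerS (vertex_walk_power (walk_init p v)).
  by have := walk_end_init vp; case: (init_arrows p v) => // vE; rewrite -vE eqxx in v1.
by exists u => //; rewrite mast_eltE.
Qed.

(** Arrows from the end of the mast leave the mast, where [U] vanishes. *)
Lemma J_socle j : J j -> j *: m (ptgt p) = 0.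
Proof.
rewrite (jacobsonE adm quot); move: j.
apply: arrow_power_ind => [|j j' jy j'y|c j jy|q q0].
- by rewrite scale0r.
- by rewrite scalerDl jy j'y addr0.
- by rewrite -scaleAK jy scaler0.
have [a [q' [_ _ _ _ ->]]] := path_cls_arrow pi q0.
rewrite -scalerA; have [ap|ap] := eqVneq (ptgt p) (src a).
  by rewrite ap cls_mast mast_eltN ?scaler0 // tgt_notin.
have -> : m (ptgt p) = e (ptgt p) *: m (ptgt p) by rewrite vertex_mast eqxx.
by rewrite (scalerA (cls a)) arrow_vertex (negbTE ap) scale0r scaler0.
Qed.

(** Composing a functional [xi] on [X] with the elements [tail v] gives candidates
    for the coordinates of a map from [X] to [U]; they satisfy the condition of
    [hom_to_mast] on arrows when [xi] vanishes on the images of these elements. *)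
Definition relator a : A := tail (tgt a) * cls a - struct a *: tail (src a).

Lemma relatorU a x : relator a *: x = 0.
Proof.
rewrite /relator scalerBl -scalerA -scaleAK !tail_scale coord_arrow scaleAK scalerA.
by rewrite subrr.
Qed.

Lemma vertex_relator a : e (ptgt p) * relator a = relator a.
Proof. by rewrite /relator mulrBr mulrA vertex_tail -scalerAr vertex_tail. Qed.

Lemma relator_vertex a : relator a * e (src a) = relator a.
Proof. by rewrite /relator mulrBl -mulrA arrow_vertex eqxx -scalerAl tail_vertex eqxx. Qed.

(** By descending induction on the length of a path [q] the product [q p] kills
    [y]: write [q = q' a] with an arrow [a].  Modulo [J^2 p], the element [a p] is
    a combination of elements of [R p], which kill [y], and [q' J^2] is spanned by
    paths longer than [q]. *)
Lemma nakayama (R : set A) (X : lmodType A) (y : X) :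
  basis_mod (mulsetr J (pcl p)) (mulsetr (jacobson2 A) (pcl p)) (mulsetr R (pcl p)) ->
  (forall r, R r -> (r * pcl p) *: y = 0) ->
  forall j, J j -> (j * pcl p) *: y = 0.
Proof.
case=> _ span _ Ry; have [l long] := long_path0 adm quot.
have short q : (0 < plen q)%N -> (pcl q * pcl p) *: y = 0.
  have [d] := ubnP (l - plen q); elim: d q => // d IH q qd q0.
  have [lq|ql] := leqP l (plen q); first by rewrite long // mul0r scale0r.
  have [a [q' [_ _ qq' _ ->]]] := path_cls_arrow pi q0.
  have [|n [c [x [xR [j Jj xE]]]]] := span (cls a * pcl p).
    by exists (cls a) => //; apply: arrow_in_J.
  have -> : pcl q' * cls a * pcl p = pcl q' * j * pcl p + pcl q' * \sum_i c i *: x i.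
    by rewrite -!mulrA xE mulrBr subrK.
  rewrite scalerDl mulr_sumr scaler_suml big1 ?addr0; last first.
    move=> i _; have [r Rr <-] := xR i.
    by rewrite -scalerAr -scaleAK -scalerA Ry // !scaler0.
  have : Pow (plen q).+1 (pcl q' * j).
    rewrite qq' -addn2; apply: arrow_powerM; first exact: arrow_power_path.
    by rewrite -(jacobson2E adm quot).
  move: (pcl q' * j); apply: arrow_power_ind => [|z z' zy z'y|k z zy|r qr].
  - by rewrite mul0r scale0r.
  - by rewrite mulrDl scalerDl zy z'y addr0.
  - by rewrite -scalerAl -scaleAK zy scaler0.
  apply: IH; last exact: leq_trans qr.
  by rewrite -ltnS; apply: leq_trans qd; rewrite ltnS ltn_sub2l.
move=> j; rewrite (jacobsonE adm quot); move: j.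
apply: arrow_power_ind => [|z z' zy z'y|k z zy|r qr].
- by rewrite mul0r scale0r.
- by rewrite mulrDl scalerDl zy z'y addr0.
- by rewrite -scalerAl -scaleAK zy scaler0.
- exact: short.
Qed.

Lemma struct_relation d (k : K) : tgt d \in pverts p -> src d \in pverts p ->
  cls d * upto (src d) = k *: upto (tgt d) -> struct d = k.
Proof.
by move=> tp sp dE; apply: struct_uniq; rewrite // !mast_eltE // scalerA dE scaleAK.
Qed.

(** * The conditions imply irreducibility *)

Section Sufficiency.

Hypothesis condB : forall b, b \in arrB p -> mulsetr J (pcl p) (cls b * upto (src b)).
Hypothesis condD : forall d, d \in arrD p ->
  exists k : K, cls d * upto (src d) = k *: upto (tgt d).

(** Condition (a) says that arrows act on the images of [y] under the initial parts
    of [p] by the structure constants of [U]; an arrow from the end of the mast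
    gives 0 because it belongs to [J]. *)
Lemma mast_universal (X : lmodType A) (y : X) :
  e (psrc p) *: y = y -> (forall j, J j -> (j * pcl p) *: y = 0) ->
  exists f : {linear U -> X}, f u = y.
Proof.
move=> vy Jy; pose yv v := if v \in pverts p then upto v *: y else 0.
have [|||f fE] := @hom_from_mast X yv; last first.
- by exists f; rewrite -mast_psrc fE ?psrc_in // /yv psrc_in upto_psrc scale1r.
- move=> a; rewrite /yv; have [sp|sp] := boolP (src a \in pverts p); last first.
    by rewrite struct_srcN // scaler0 !scale0r.
  have [tp|tp] := boolP (tgt a \in pverts p).
    rewrite scalerA scaleAK; congr (_ *: _).
    have [ap|ap] := boolP (a \in parr p); first by rewrite struct_path // scale1r upto_arrow.
    have [|k kE] := condD (d := a); first by rewrite inE sp tp.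
    by rewrite (struct_relation tp sp kE).
  rewrite scaler0 scalerA; have [sn|sn] := eqVneq (src a) (ptgt p).
    rewrite sn -vy scalerA -mulrA upto_ptgt //; apply: Jy; exact: arrow_in_J.
  have [|j Jj <-] := condB (b := a); last exact: Jy.
  by rewrite inE mem_take_pverts // sp sn.
- by move=> v vp; rewrite /yv (negbTE vp).
- move=> v; rewrite /yv; case: ifP => vp; last by rewrite scaler0.
  by rewrite scalerA -vy !scalerA -mulrA vertex_upto.
Qed.

Variable R : set A.
Hypothesis RJ : R `<=` J.
Hypothesis Rbasis :
  basis_mod (mulsetr J (pcl p)) (mulsetr (jacobson2 A) (pcl p)) (mulsetr R (pcl p)).
Hypothesis condC : forall c, c \in arrC p -> exists2 w, mulsetl (pcl p) J w &
  forall r, R r -> r * from (tgt c) * cls c = r * w.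
Hypothesis condDR : forall d, d \in arrD p -> forall r, R r ->
  exists k : K, r * from (tgt d) * cls d = k *: (r * from (src d)).

Lemma basis_neq0 r : R r -> r * pcl p != 0.
Proof.
move=> Rr; apply/eqP => r0; have [_ _ ind] := Rbasis.
have /eqP : 1 = 0 :> K; last by rewrite oner_eq0.
apply: (ind 1%N (fun=> 1) (fun=> r * pcl p) _ _ _ ord0) => [_|i j _|].
- by exists r.
- by rewrite !ord1.
rewrite big_ord1 scale1r r0; exists 0; last by rewrite mul0r.
by rewrite (jacobson2E adm quot); apply: arrow_power0.
Qed.

(** For an arrow into the mast from outside this is condition (i).  For an arrow
    of [D] both sides vanish: the scalar in (ii) must be the structure constant,
    as multiplication by the initial part of [p] up to the source of the arrow
    shows, since [r p <> 0].  The relators of the remaining arrows are 0, except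
    that the relator of an arrow [a] into the start of the mast is [p a]. *)
Lemma relator_shift a : exists2 w, J w & forall r, R r -> r * relator a = r * pcl p * w.
Proof.
have [tp|tp] := boolP (tgt a \in pverts p); last first.
  exists 0; first by rewrite (jacobsonE adm quot); apply: arrow_power0.
  move=> r _; rewrite /relator /tail (negbTE tp) mul0r struct_tgtN // scale0r.
  by rewrite subr0 !mulr0.
have [t1|t1] := eqVneq (tgt a) (psrc p).
  exists (cls a); first exact: arrow_in_J.
  by move=> r _; rewrite /relator t1 tail_psrc struct_srcN ?src_notin // scale0r subr0 mulrA.
have [sp|sp] := boolP (src a \in pverts p); last first.
  have [|_ [j Jj <-] jE] := condC (c := a).
    by rewrite inE sp mem_behead_pverts // tp t1.
  exists j => // r Rr; rewrite /relator tail_cls // struct_srcN // scale0r subr0.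
  by rewrite mulrA jE // mulrA.
exists 0; first by rewrite (jacobsonE adm quot); apply: arrow_power0.
move=> r Rr; rewrite mulr0 /relator tail_cls //.
have [ap|ap] := boolP (a \in parr p).
  rewrite struct_path // scale1r -from_arrow // /tail sp from_vertex ?subrr ?mulr0 //.
  by apply: contraL tp => /eqP /tgt_notin.
have aD : a \in arrD p by rewrite inE sp tp.
have [k kE] := condDR aD Rr; have [k' k'E] := condD aD.
have sn : src a != ptgt p by apply: contraL tp => /eqP /tgt_notin.
rewrite /tail sp from_vertex // mulrBr mulrA kE -scalerAr -scalerBl.
rewrite (struct_relation tp sp k'E); have [->|kk'] := eqVneq k k'; first by rewrite subrr scale0r.
case/eqP: (basis_neq0 Rr).
have kk : k *: (r * pcl p) = k' *: (r * pcl p).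
  transitivity (r * from (tgt a) * cls a * (upto (src a) * e (psrc p))).
    by rewrite kE -scalerAl -mulrA from_upto_vertex.
  by rewrite -!mulrA (mulrA (cls a)) k'E -scalerAl -!scalerAr from_upto_vertex.
have : (k - k') *: (r * pcl p) = 0 by rewrite scalerBl kk subrr.
move/(congr1 (fun z => (k - k')^-1 *: z)).
by rewrite scalerA mulVf ?subr_eq0 // scale1r scaler0.
Qed.

Section Factorization.
Variables (X : lmodType A).
Variable h : {linear submod_type (smul_is_submod J [set: U]) -> X}.
Variable soc : submod_type (smul_is_submod J [set: U]).
Hypothesis soc_val : submod_incl (smul_is_submod J [set: U]) soc = m (ptgt p).

Local Notation incl := (submod_incl (smul_is_submod J [set: U])).

(** The subspace on which the coordinate functional at the end of the mast of a
    retraction onto [JU] has to vanish: relators kill [U], and [p] kills [JU]. *)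
Definition relator_image : set X := [set x | exists (x1 : X) (xa : arrow Q -> X),
  x = pcl p *: x1 + \sum_a relator a *: xa a].

Lemma split_mono_of_notin_image : ~ relator_image (h soc) -> split_mono h.
Proof.
move=> notW; pose Xk := restrict_scalars X.
have sW : @is_submod K Xk relator_image.
  apply/is_submodP; split.
  - exists 0, (fun=> 0); rewrite scaler0 add0r big1 // => a _; exact: scaler0.
  - move=> _ _ [x1 [xa ->]] [y1 [ya ->]]; exists (x1 + y1), (fun a => xa a + ya a).
    rewrite scalerDr addrACA; congr (_ + _); rewrite -big_split.
    by apply: eq_bigr => a _; rewrite scalerDr.
  - move=> c _ [x1 [xa ->]]; exists (c%:A *: x1), (fun a => c%:A *: xa a).
    rewrite -[c *: _]/(c%:A *: (_ : X)) scalerDr scaleAC scaler_sumr; congr (_ + _).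
    by apply: eq_bigr => a _; rewrite scaleAC.
(* [ev] becomes the coordinate at the end of the mast; the coordinate at [v] is
   then forced to be [ev] composed with [tail v]. *)
have [ev [evW ev1]] := separating_functional sW notW.
pose xi v (x : X) : K := ev (tail v *: x : Xk).
have evZ (c : K) (x : X) : ev (c%:A *: x) = c * ev x :> K by exact: (linearZ_LR ev c (x : Xk)).
have evD (x y : X) : ev (x + y) = ev x + ev y :> K by exact: (linearD ev (x : Xk) y).
have [||||f fE] := @hom_to_mast X xi.
- by move=> v x y; rewrite /xi scalerDr evD.
- by move=> v c x; rewrite /xi -scaleAC evZ.
- move=> v w x; rewrite /xi scalerA tail_vertex eq_sym; case: eqP => // _.
  by rewrite scale0r; apply: (linear0 ev).
- move=> a x _; rewrite /xi scalerA.
  have -> : tail (tgt a) * cls a = relator a + struct a *: tail (src a) by rewrite subrK.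
  rewrite scalerDl -scaleAK evD evZ evW ?add0r //.
  exists 0, (fun b => if b == a then x else 0); rewrite scaler0 add0r (bigD1 a) //= eqxx.
  by rewrite big1 ?addr0 // => b /negbTE ->; rewrite scaler0.
have [|r rE] := @corestrict _ _ _ _ (smul_is_submod J [set: U]) f.
  have /is_submodP[S0 _ SZ] := smul_is_submod J [set: U].
  move=> x; rewrite fE; apply: submod_sum => [|v _]; first exact: smul_is_submod.
  have [vp|vp] := boolP (v \in pverts p); last by rewrite mast_eltN // scaler0.
  have [->|v1] := eqVneq v (psrc p); last by apply: SZ; apply: JU_mast.
  rewrite /xi tail_psrc evW ?scale0r ?scale0r //.
  by exists x, (fun=> 0); rewrite big1 ?addr0 // => a _; rewrite scaler0.
exists r => j; apply: val_inj; rewrite -[LHS]/(incl (r (h j))) rE fE.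
rewrite -[RHS]/(incl j) [RHS]mast_decomp; apply: eq_bigr => v _; congr (_%:A *: _).
rewrite /xi -linearZ /=.
have -> : tail v *: j = (coord v (incl j))%:A *: soc.
  apply: val_inj; rewrite -[LHS]/(incl (tail v *: j)) -[RHS]/(incl (_ *: soc)) !linearZ /=.
  by rewrite -[val soc]/(incl soc) soc_val -tail_scale.
by rewrite linearZ /= evZ ev1 mulr1.
Qed.

Variable g : {linear X -> U}.
Hypothesis gh : incl =1 g \o h.

Lemma split_epi_of_in_image : relator_image (h soc) -> split_epi g.
Proof.
move=> [x1 [xa hE]].
have /cid[w wP] : exists w : arrow Q -> A, forall a, J (w a) /\
    forall r, R r -> r * relator a = r * pcl p * w a.
  pose w a := sval (cid2 (relator_shift a)).
  by exists w => a; rewrite /w; case: cid2.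
(* Applying [g] to the equation for [h soc] kills the relators. *)
have cx1 : coord (psrc p) (g x1) = 1.
  have := gh soc; rewrite soc_val /= hE linearD linear_sum /= linearZ /=.
  rewrite big1 ?addr0; last by move=> a _; rewrite linearZ /= relatorU.
  by rewrite mast_path_coord => mE; apply: (scaleK_inj (ptgt_in p)); rewrite -mE !scale1r.
pose y := e (psrc p) *: (x1 + \sum_a w a *: xa a).
have gy : g y = u.
  rewrite linearZ /= coordE linearD coordD cx1 linear_sum /= JU_coord ?addr0.
    by rewrite !scale1r mast_psrc.
  apply: submod_sum => [|a _]; first exact: smul_is_submod.
  rewrite linearZ /=; apply: sub_submod_span; exists (w a); first exact: (wP a).1.
  by exists (g (xa a)).
have [||f fE] := @mast_universal X y; last 1 first.
- exists f; apply: (@eq_on_top U (g \o f) idfun); by rewrite /= fE gy.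
- by rewrite /y scalerA vertex_idem.
apply: (nakayama Rbasis) => r Rr; rewrite /y scalerA -mulrA mast_path_vertex scalerDr.
rewrite scaler_sumr (eq_bigr (fun a => r *: (relator a *: xa a))); last first.
  by move=> a _; rewrite !scalerA (wP a).2.
rewrite -scalerA -scaler_sumr -scalerDr -hE -linearZ /=.
have -> : r *: soc = 0; last exact: linear0.
apply: val_inj; rewrite -[LHS]/(incl (r *: soc)) linearZ /= -[val soc]/(incl soc) soc_val.
by rewrite J_socle //; apply: RJ.
Qed.

End Factorization.

Lemma irreducible_of_conditions : psrc p != ptgt p ->
  irreducible_map (submod_incl (smul_is_submod J [set: U])).
Proof.
move=> n2; have JUn : JU (m (ptgt p)) by rewrite eq_sym in n2; apply: JU_mast; rewrite ?ptgt_in.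
pose soc : submod_type (smul_is_submod J [set: U]) := exist _ (m (ptgt p)) (mem_set JUn).
split.
- move=> [r rK]; have ru : submod_incl (smul_is_submod J [set: U]) (r u) = 0.
    have : JU (val (r u)) by apply: set_mem; apply: (valP (r u)).
    move/JU_coord => c0; rewrite -{1}vertex_u linearZ linearZ /= coordE c0 !scale0r //.
  have : submod_incl (smul_is_submod J [set: U]) (r (submod_incl _ soc)) = 0.
    have [y yE] := mast_generates (submod_incl _ soc).
    by rewrite yE (linearZ_LR r) (linearZ_LR (submod_incl _)) ru scaler0.
  by rewrite rK => /eqP; rewrite (negbTE (mast_neq0 (ptgt_in p))).
- move=> [s sK]; have := JU_coord (set_mem (valP (s u))).
  rewrite -[val _]/(submod_incl _ (s u)) sK -mast_psrc coord_mast eqxx psrc_in /=.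
  by move/eqP; rewrite oner_eq0.
move=> X g h _ gh.
have [im|im] := pselect (relator_image (h soc)).
  right; exact: (split_epi_of_in_image (soc := soc) (h := h)).
left; exact: (split_mono_of_notin_image (soc := soc)).
Qed.

End Sufficiency.

(** * Irreducibility implies the conditions *)

Lemma pverts_trivial : psrc p = ptgt p -> forall v, v \in pverts p -> v = psrc p.
Proof.
move=> pp v; have /size0nil p0 := acyc pp.
by rewrite /pverts p0 inE => /eqP.
Qed.

Lemma mast_line : psrc p = ptgt p -> forall x, x = (coord (psrc p) x)%:A *: u.
Proof.
move=> pp x; rewrite {1}(mast_decomp x) (bigD1 (psrc p)) //= mast_psrc big1 ?addr0 // => v v1.
by rewrite mast_eltN ?scaler0 //; apply: contraNN v1 => /(pverts_trivial pp) ->.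
Qed.

Lemma simple_mast : simple_module U <-> psrc p = ptgt p.
Proof.
split=> [sU|pp].
  apply/eqP/contraT => n2; have [_ _ _ _ h] := sU.
  have [] := h JU (smul_is_submod J _).
  - by move=> _ ->; have /is_submodP[] := smul_is_submod J [set: U].
  - by [].
  - move=> JU0; have : JU (m (ptgt p)) by apply: JU_mast; rewrite ?ptgt_in // eq_sym.
    by rewrite JU0 => /eqP; rewrite (negbTE (mast_neq0 (ptgt_in p))).
  move=> JUT; have := @JU_coord u; rewrite JUT => /(_ Logic.I).
  by rewrite -mast_psrc coord_mast eqxx psrc_in => /eqP; rewrite oner_eq0.
split=> //; first exact: submod_set0.
- exact: submod_setT.
- move=> uT; have : [set: U] u by [].
  by rewrite -uT => /eqP; rewrite -mast_psrc (negbTE (mast_neq0 (psrc_in p))).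
move=> N sN _ _; have /is_submodP[N0 ND NZ] := sN.
have [NN|NN] := pselect (exists2 z, N z & z != 0); last first.
  left; apply/seteqP; split=> [z Nz|_ ->] //=; apply/eqP/contraT => z0.
  by case: NN; exists z.
right; apply/seteqP; split=> // x _; have [z Nz z0] := NN.
have c0 : coord (psrc p) z != 0.
  by apply: contra_neq z0 => c0; rewrite (mast_line pp z) c0 !scale0r.
rewrite (mast_line pp x).
have -> : u = ((coord (psrc p) z)^-1)%:A *: z.
  by rewrite {2}(mast_line pp z) scaleAK scalerA mulVf // !scale1r.
by do 2 apply: (NZ).
Qed.

Section Necessity.

Local Notation JUT := (submod_type (smul_is_submod J [set: U])).
Local Notation incl := (submod_incl (smul_is_submod J [set: U])).
Hypothesis irr : irreducible_map incl.

Lemma irreducible_nontrivial : psrc p != ptgt p.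
Proof.
apply/eqP => pp; have [nsm _ _] := irr; apply: nsm.
have [|z zE] := @linear_of _ U JUT (fun=> 0); first by move=> a x y; rewrite scaler0 addr0.
exists z => x; rewrite zE; apply: val_inj.
by rewrite [RHS](mast_line pp) JU_coord ?scale0r ?scale0r //; apply: set_mem; apply: (valP x).
Qed.

Lemma JUT_elt v : exists j : JUT, incl j = if v == psrc p then 0 else m v.
Proof.
have [_|v1] := eqVneq v (psrc p); first by exists 0; rewrite linear0.
have [vp|vp] := boolP (v \in pverts p); last by exists 0; rewrite linear0 mast_eltN.
by exists (exist _ (m v) (mem_set (JU_mast vp v1))).
Qed.

Lemma JUT_decomp (j : JUT) (b : vertex Q -> JUT) :
  (forall v, incl (b v) = if v == psrc p then 0 else m v) ->
  j = \sum_v (coord v (incl j))%:A *: b v.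
Proof.
move=> bE; apply: val_inj; rewrite -[RHS]/(incl _) linear_sum /= -[LHS]/(incl j).
rewrite [LHS]mast_decomp; apply: eq_bigr => v _; rewrite -[RHS]/(incl (_ *: b v)) linearZ /=.
rewrite -[val (b v)]/(incl (b v)) bE; case: eqP => [->|//].
by rewrite JU_coord ?scale0r ?scale0r //; apply: set_mem; apply: (valP j).
Qed.

(** The module [X] is the quotient of [JU + A + A^arrows] by the submodule generated
    by [g0].  It is finitely generated, the embedding of [JU] factors through it,
    and the map from [JU] to it cannot split, so the map [g] to [U] does.
    The image of [u] under a section has the form [e_1 l x + \sum_a e_1 f_a y_a],
    its component in [JU] being 0 as [e_1 JU = 0]; absence of cycles gives
    [e_1 l e_1 = e_1].  An element [s] that kills [u] kills this image, that is,
    it sends it to a multiple [t g0] of the relation. *)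
Lemma test_module (q : arrow Q -> A) : (forall a x, q a *: x = 0) ->
  exists nu : arrow Q -> A, forall s, s *: u = 0 ->
    exists t, [/\ t *: m (ptgt p) = 0, s * e (psrc p) = t * pcl p
                & forall a, s * e (psrc p) * nu a = t * q a].
Proof.
move=> qU; have /cid[b bE] : exists b : vertex Q -> JUT,
    forall v, incl (b v) = if v == psrc p then 0 else m v.
  by exists (fun v => sval (cid (JUT_elt v))) => v; case: cid.
pose F : lmodType A := {ffun arrow Q -> A^o}.
pose M0 : lmodType A := (JUT * (A^o * F))%type.
pose g0 : M0 := (b (ptgt p), (- pcl p : A^o, [ffun a => q a : A^o] : F)).
pose N : set M0 := [set t *: g0 | t in [set: A]].
have sN : is_submod N.
  apply/is_submodP; split; first by exists 0; rewrite // scale0r.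
  - by move=> _ _ [s _ <-] [t _ <-]; exists (s + t); rewrite // scalerDl.
  - by move=> a _ [s _ <-]; exists (a * s); rewrite // scalerA.
have [X [G [Gsurj GN]]] := quotient_module sN.
have [ev evE] : exists ev : {linear M0 -> U}, forall z, ev z = incl z.1 + (z.2.1 : A) *: u.
  apply: linear_of => a x y; rewrite [(a *: x + y).1]/(a *: x.1 + y.1) linearP.
  rewrite -[(a *: x + y).2.1 : A]/(a * x.2.1 + y.2.1) scalerDl scalerDr -scalerA.
  by rewrite addrACA.
have evg0 : ev g0 = 0.
  rewrite evE -[g0.1]/(b (ptgt p)) -[g0.2.1]/(- pcl p) bE eq_sym.
  by rewrite (negbTE irreducible_nontrivial) scaleNr mast_ptgt subrr.
have [g gG] : exists g : {linear X -> U}, forall z, g (G z) = ev z.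
  by apply: linear_factor => // z /GN[t _ <-]; rewrite linearZ /= evg0 scaler0.
have [h hE] : exists h : {linear JUT -> X}, forall j, h j = G (j, 0).
  apply: linear_of => a x y; rewrite -linearP; congr (G _).
  by rewrite -[RHS]/(_, _) /= scaler0 addr0.
have [i iE] : exists i : {linear A^o -> X}, forall l, i l = G (0, (l, 0)).
  apply: linear_of => a x y; rewrite -linearP; congr (G _).
  by rewrite -[RHS]/(_, (_, _)) /= !scaler0 !addr0.
have [k kE] : exists k : {linear F -> X}, forall f, k f = G (0, (0, f)).
  apply: linear_of => a x y; rewrite -linearP; congr (G _).
  by rewrite -[RHS]/(_, (_, _)) /= !scaler0 !addr0.
have Gsplit j l f : G (j, (l, f)) = h j + i l + k f.
  rewrite hE iE kE -!linearD; congr (G _).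
  by rewrite -[RHS]/(_, (_, _)) /= !addr0 !add0r.
pose delta a : F := [ffun b => if b == a then 1 else 0].
have k_sum f : k f = \sum_a (f a : A) *: k (delta a).
  have fE : f = \sum_a (f a : A) *: delta a.
    apply/ffunP => c; rewrite sum_ffunE (bigD1 c) //= big1 ?addr0.
      by rewrite !ffunE eqxx -[RHS]/(_ * _) mulr1.
    by move=> a ac; rewrite !ffunE eq_sym (negbTE ac) scaler0.
  by rewrite {1}fE linear_sum; apply: eq_bigr => a _; rewrite linearZ.
have i1 l : i l = (l : A) *: i 1 by rewrite -linearZ /= -[_ *: _]/(_ * _) mulr1.
have fgX : fin_generated X.
  exists (i 1 :: [seq h (b v) | v : vertex Q] ++ [seq k (delta a) | a : arrow Q]).
  apply/seteqP; split=> // x _ L sL gL; have [[j [l f]] <-] := Gsurj x.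
  have /is_submodP[_ LD LZ] := sL; rewrite Gsplit; apply: (LD); first apply: (LD).
  - rewrite (JUT_decomp j bE) linear_sum; apply: submod_sum => // v _.
    rewrite linearZ; apply/LZ/gL; rewrite /= in_cons mem_cat; apply/or3P.
    by apply: Or32; apply/mapP; exists v; rewrite ?mem_enum.
  - by rewrite i1; apply/LZ/gL; rewrite /= mem_head.
  - rewrite k_sum; apply: submod_sum => // a _; apply/LZ/gL.
    rewrite /= in_cons mem_cat; apply/or3P.
    by apply: Or33; apply/mapP; exists a; rewrite ?mem_enum.
have gh : incl =1 g \o h.
  by move=> j; rewrite /= hE gG evE scale0r addr0.
have JUT_top (j : JUT) : coord (psrc p) (incl j) = 0.
  by apply: JU_coord; apply: set_mem; apply: (valP j).
have [_ _ irrX] := irr; have [[r hr]|[s0 gs]] := irrX X g h fgX gh.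
  have : G g0 = 0 by apply/GN; exists 1; rewrite // scale1r.
  have [ir irE] : exists ir : {linear X -> U}, ir =1 incl \o r.
    by apply: linear_of => a x y; rewrite /comp (linearP r) (linearP incl).
  have irh j : ir (h j) = incl j by rewrite irE /= hr.
  rewrite Gsplit i1 k_sum => /(congr1 ir).
  rewrite linear0 !linearD irh linearZ linear_sum big1; last first.
    by move=> a _; rewrite linearZ ffunE; apply: qU.
  rewrite -[X in _ + X + _]/(- pcl p *: ir (i 1)) (irE (i 1)) /comp.
  rewrite addr0 scaleNr mast_path_coord JUT_top !scale0r oppr0 addr0 bE eq_sym.
  rewrite (negbTE irreducible_nontrivial) => /eqP.
  by rewrite (negbTE (mast_neq0 (ptgt_in p))).
have [[j [l f]] s0E] := Gsurj (s0 u).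
set e1 := e (psrc p); have {}s0E : s0 u = i (e1 * l) + k (e1 *: f).
  rewrite -vertex_u linearZ /= -s0E Gsplit !scalerDr -!linearZ /=.
  have -> : e1 *: j = 0; last by rewrite (linear0 h) add0r.
  by apply: val_inj; rewrite -[LHS]/(incl (e1 *: j)) linearZ /= coordE JUT_top !scale0r.
have gi (y : A) : g (i y) = y *: u by rewrite iE gG evE [incl _](linear0 incl) add0r.
have gk y : g (k y) = 0 by rewrite kE gG evE [incl _](linear0 incl) scale0r addr0.
have lu : (e1 * l) *: u = u.
  by rewrite -gi -[RHS]gs s0E linearD gk addr0.
have vu : e1 *: u = u := vertex_u.
have ee : e1 * e1 = e1 := vertex_idem pi (psrc p).
have le : e1 * l * e1 = e1.
  have [c [y [Py yE]]] := local_decomp quot (psrc p) l.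
  have e1y : e1 * y * e1 = 0.
    by apply: (corner0 Py) => q' q1 q2; rewrite (no_path_to_psrc acyc (psrc_in p) q1 q2).
  have lE : e1 * l * e1 = c *: e1.
    transitivity (e1 * (l * e1) * e1); first by rewrite -!mulrA ee.
    by rewrite yE mulrDr mulrDl e1y addr0 -scalerAr -scalerAl !ee.
  rewrite lE; suff -> : c = 1 by rewrite scale1r.
  apply: (scaleK_inj (psrc_in p)); rewrite mast_psrc !scale1r -[RHS]lu.
  by rewrite -[in RHS]vu scalerA lE -(scaleAK c e1) vu.
exists (fun a => - (e1 * f a)) => s su.
have /GN[t _ tE] : G (0, (s * (e1 * l), s *: (e1 *: f))) = 0.
  rewrite Gsplit linear0 add0r -[s * _]/(s *: (_ : A^o)) !(linearZ_LR _ s) -scalerDr.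
  by rewrite -s0E -linearZ /= su linear0.
have t1 : t *: b (ptgt p) = 0 by have := congr1 (fun z : M0 => z.1) tE.
have t2 : t * (- pcl p) = s * (e1 * l) by have := congr1 (fun z : M0 => z.2.1) tE.
have t3 a : t * q a = s * (e1 * f a).
  by have := congr1 (fun z : M0 => z.2.2 a) tE; rewrite /= !ffunE.
exists (- t); split.
- have /(congr1 incl) := t1; rewrite linear0 (linearZ_LR incl) bE eq_sym.
  by rewrite (negbTE irreducible_nontrivial) scaleNr => ->; rewrite oppr0.
- by rewrite mulNr -mulrN -[pcl p]mast_path_vertex -mulNr mulrA t2 -mulrA le.
- by move=> a; rewrite mulrN mulNr t3 !mulrA -(mulrA s) ee.
Qed.

(** The element [t] of [test_module] may be multiplied by the idempotent of the end
    of the mast on the right; being zero on the socle it then lies in [J]. *)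
Lemma annihilator_lift : exists nu : arrow Q -> A, forall s, s *: u = 0 ->
  exists t, [/\ J t, s * e (psrc p) = t * pcl p
              & forall a, s * e (psrc p) * nu a = t * relator a].
Proof.
have [nu nuE] := test_module relatorU; exists nu => s /nuE[t [tm sE sa]].
exists (t * e (ptgt p)); split; last 2 first.
- by rewrite -(mulrA t) vertex_mast_path.
- by move=> a; rewrite -(mulrA t) vertex_relator.
have [c [j [Pj tE]]] := local_decomp quot (ptgt p) t.
suff c0 : c = 0 by rewrite tE c0 scale0r add0r (jacobsonE adm quot).
apply: (scaleK_inj (ptgt_in p)); rewrite !scale0r.
have : (t * e (ptgt p)) *: m (ptgt p) = 0 by rewrite -scalerA vertex_mast eqxx.
have Jj : J j by rewrite (jacobsonE adm quot).
rewrite tE scalerDl (J_socle Jj) addr0 -(scaleAK c (e _)).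
by rewrite vertex_mast eqxx.
Qed.

Lemma annihilator_sub s : s *: u = 0 -> mulsetr J (pcl p) (s * e (psrc p)).
Proof.
have [nu nuE] := annihilator_lift.
by move=> /nuE[t [Jt -> _]]; exists t.
Qed.

Lemma necessary_B b : b \in arrB p -> mulsetr J (pcl p) (cls b * upto (src b)).
Proof.
rewrite inE mem_take_pverts // => /andP[/andP[sp _] tp].
rewrite -cls_upto_vertex //; apply: annihilator_sub.
by rewrite -scalerA -mast_eltE // cls_mast mast_eltN // scaler0.
Qed.

(** The difference of both sides kills [u], hence lies in [Jp].  It also lives at a
    vertex of the mast, to which no nontrivial path leads from the end of [p]. *)
Lemma necessary_D d : d \in arrD p ->
  cls d * upto (src d) = struct d *: upto (tgt d).
Proof.
rewrite inE => /and3P[sp tp _]; apply/eqP; rewrite -subr_eq0; apply/eqP.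
pose s := cls d * upto (src d) - struct d *: upto (tgt d).
have t1 : tgt d != psrc p by apply: contraL sp => /eqP /src_notin.
have sE : s * e (psrc p) = s.
  by rewrite mulrBl cls_upto_vertex // -scalerAl upto_vertex.
have vs : e (tgt d) * s = s.
  rewrite mulrBr mulrA vertex_arrow eqxx -scalerAr -(upto_vertex _ tp t1).
  by rewrite vertex_upto // upto_vertex.
have [|t Jt tE] := @annihilator_sub s.
  by rewrite scalerBl -scalerA -scaleAK -!mast_eltE // cls_mast subrr.
rewrite -/s -vs -sE -tE -(vertex_mast_path pi p) !mulrA (corner0 (k := 1)) ?mul0r //.
  by rewrite -(jacobsonE adm quot).
by move=> r r1 r2; rewrite (no_path_from_ptgt acyc tp r1 r2).
Qed.

Lemma J_arrows j : J j -> exists c : arrow Q -> K,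
  jacobson2 A (j - \sum_a c a *: cls a).
Proof.
rewrite (jacobsonE adm quot) (jacobson2E adm quot); move: j.
apply: arrow_power_ind => [|j j' [c jE] [c' j'E]|k j [c jE]|q q0].
- exists (fun=> 0); rewrite big1 ?subr0; first exact: arrow_power0.
  by move=> a _; rewrite scale0r.
- exists (fun a => c a + c' a).
  rewrite (eq_bigr (fun a => c a *: cls a + c' a *: cls a)); last first.
    by move=> a _; rewrite scalerDl.
  by rewrite big_split opprD addrACA; apply: arrow_powerD.
- exists (fun a => k * c a).
  rewrite (eq_bigr (fun a => k *: (c a *: cls a))); last first.
    by move=> a _; rewrite scalerA.
  by rewrite -scaler_sumr -scalerBr; apply: arrow_powerZ.
have [q1|q1] := leqP (plen q) 1; last first.
  exists (fun=> 0); rewrite big1 ?subr0; first exact: arrow_power_path.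
  by move=> a _; rewrite scale0r.
have [a [q' [q'1 _ qq' _ qE]]] := path_cls_arrow pi q0.
exists (fun b => if b == a then 1 else 0).
rewrite (bigD1 a) //= eqxx scale1r big1 ?addr0; last by move=> b /negbTE ->; rewrite scale0r.
have q'0 : plen q' = 0%N by move: q1; rewrite qq' ltnS leqn0 => /eqP.
rewrite qE (path_nil q'0) q'1 -[path_cls _ _]/(e (tgt a)) vertex_arrow eqxx subrr.
exact: arrow_power0.
Qed.

(** For each arrow [a], lift [a p], which kills [u], to some [f a] in [J] with
    [f a p = a p] and [f a (relator b) = f a p nu_b]; [R] consists of those [f a]
    for which the [a p] form a basis.  For [b] in [C] the last equation is (i).
    For [b] in [D] with source other than the start of the mast, [e_1 nu_b e_s(b)]
    vanishes for lack of paths, so [f a] kills the relator, which is (ii). *)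
Lemma necessary_R : exists R : set A,
  [/\ R `<=` J,
      basis_mod (mulsetr J (pcl p)) (mulsetr (jacobson2 A) (pcl p)) (mulsetr R (pcl p)),
      forall c, c \in arrC p -> exists2 w, mulsetl (pcl p) J w &
        forall r, R r -> r * from (tgt c) * cls c = r * w
    & forall d, d \in arrD p -> forall r, R r ->
        exists k : K, r * from (tgt d) * cls d = k *: (r * from (src d))].
Proof.
have [nu nuE] := annihilator_lift.
have /cid[f fP] : exists f : arrow Q -> A, forall a,
    [/\ J (f a), f a * pcl p = cls a * pcl p
      & forall b, f a * relator b = f a * pcl p * nu b].
  have ex a : exists t, [/\ J t, t * pcl p = cls a * pcl p
      & forall b, t * relator b = t * pcl p * nu b].
    have [|t [Jt tE tb]] := nuE (cls a * pcl p).
      by rewrite -scalerA -mast_ptgt J_socle //; apply: arrow_in_J.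
    move: tE tb; rewrite -mulrA mast_path_vertex => tE tb.
    by exists t; split=> // b; rewrite -tb tE.
  by exists (fun a => sval (cid (ex a))) => a; case: cid.
(* The arrows [a] give the elements [a p] that span [Jp] modulo [J^2 p]. *)
have [||| S Sbasis] := @basis_mod_of_spanning K A (mulsetr J (pcl p))
  (mulsetr (jacobson2 A) (pcl p)) (arrow Q) (fun a => cls a * pcl p).
- apply/is_submodP; rewrite (jacobson2E adm quot); split.
  + by exists 0; rewrite ?mul0r //; apply: arrow_power0.
  + move=> _ _ [x Px <-] [y Py <-]; exists (x + y); rewrite ?mulrDl //.
    exact: arrow_powerD.
  + move=> c _ [x Px <-]; exists (c *: x); last by rewrite -scalerAl.
    exact: arrow_powerZ.
- by move=> a; exists (cls a) => //; apply: arrow_in_J.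
- move=> _ [j /J_arrows[c Jc] <-]; exists c, (j - \sum_a c a *: cls a) => //.
  by rewrite mulrBl mulr_suml; congr (_ - _); apply: eq_bigr => a _; rewrite -scalerAl.
exists [set f a | a in [set a | a \in S]]; split.
- by move=> _ [a _ <-]; have [] := fP a.
- suff -> : mulsetr [set f a | a in [set a | a \in S]] (pcl p)
      = [set cls a * pcl p | a in [set a | a \in S]] by [].
  apply/seteqP; split=> [_ [_ [a aS <-] <-]|_ [a aS <-]].
    by exists a => //; have [] := fP a.
  by exists (f a); [exists a | have [] := fP a].
- move=> c; rewrite inE mem_behead_pverts // => /and3P[sp tp t1].
  have s1 : psrc p != src c by apply: contraNneq sp => <-; apply: psrc_in.
  exists (pcl p * (e (psrc p) * nu c * e (src c))).
    exists (e (psrc p) * nu c * e (src c)) => //.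
    by rewrite (jacobsonE adm quot); apply: (offdiag quot).
  move=> _ [a _ <-]; have [_ _ fE] := fP a.
  have := congr1 (fun z => z * e (src c)) (fE c).
  rewrite -mulrA relator_vertex {1}/relator tail_cls // struct_srcN // scale0r subr0.
  by rewrite -!mulrA => ->; rewrite (mulrA (pcl p) (e _)) mast_path_vertex.
move=> d dD _ [a _ <-]; have [_ _ fE] := fP a; exists (struct d).
have dE := necessary_D dD; move: dD; rewrite inE => /and3P[sp tp _].
have [s1|s1] := eqVneq (src d) (psrc p).
  move: dE; rewrite s1 upto_psrc mulr1 => ->.
  by rewrite -scalerAr -mulrA from_upto.
have sn : src d != ptgt p by apply: contraL tp => /eqP /tgt_notin.
have := congr1 (fun z => z * e (src d)) (fE d).
rewrite -mulrA relator_vertex -(mast_path_vertex pi p) -!mulrA (mulrA (e _) (nu d)).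
rewrite (corner0 (k := 0)) ?mulr0; last 2 first.
- exact: (arrow_power0T quot).
- move=> r r1 r2; have r0 := no_path_to_psrc acyc sp r1 r2.
  by case/eqP: s1; rewrite -r1 -r2 {2}(path_nil r0).
rewrite /relator tail_cls // /tail sp from_vertex // mulrBr mulrA => /eqP.
by rewrite subr_eq0 => /eqP ->; rewrite scalerAr.
Qed.

End Necessity.
End MastModule.

Theorem corollary4p6 (K : fieldType) (Q : quiver)
    (I : set (path_algebra K Q)) (Lambda : algType K)
    (pi : {lrmorphism path_algebra K Q -> Lambda})
    (U : lmodType Lambda) (p : qpath Q) :
  admissible I ->
  is_quotient_map pi I ->
  no_directed_cycle Q ->
  left_multiserial Lambda ->
  fin_generated U ->
  uniserial [set: U] ->
  is_mast pi U p ->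
  let J : set Lambda := jacobson Lambda in
  let J2 : set Lambda := jacobson2 Lambda in
  let pbar : Lambda := pi (pathelt K p) in
  let cls := arrow_cls pi in
  let upto := path_upto pi p in
  let from := path_from pi p in
  irreducible_map (submod_incl (smul_is_submod J [set: U]))
  <->
  [/\ ~ simple_module U,
      (forall b, b \in arrB p -> mulsetr J pbar (cls b * upto (src b))) /\
      (forall d, d \in arrD p ->
         exists k : K, cls d * upto (src d) = k *: upto (tgt d))
    & exists R : set Lambda,
      [/\ R `<=` J,
          basis_mod (mulsetr J pbar) (mulsetr J2 pbar) (mulsetr R pbar),
          forall c, c \in arrC p -> exists2 w, mulsetl pbar J w &
            forall r, R r -> r * from (tgt c) * cls c = r * w
        & forall d, d \in arrD p -> forall r, R r ->
            exists k : K, r * from (tgt d) * cls d = k *: (r * from (src d))]].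
Proof.
move=> adm quot acyc _ _ _ [lenU [x px]].
pose u := vertex_cls pi (psrc p) *: x.
have vu : vertex_cls pi (psrc p) *: u = u by rewrite scalerA vertex_idem.
have pu : path_cls pi p *: u != 0 by rewrite scalerA mast_path_vertex.
have simpleE := simple_mast adm quot acyc lenU vu pu.
split=> [irr|[nsimple [condB condD] [R [RJ Rbasis condC condDR]]]].
  split.
  - move/simpleE => pp; have := irreducible_nontrivial adm quot acyc lenU vu pu irr.
    by rewrite pp eqxx.
  - split; first exact: (necessary_B adm quot acyc lenU vu pu irr).
    by move=> d dD; eexists; exact: (necessary_D adm quot acyc lenU vu pu irr dD).
  - exact: (necessary_R adm quot acyc lenU vu pu irr).
apply: (irreducible_of_conditions adm quot acyc lenU vu pu condB condD RJ Rbasis condC condDR).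
by apply/eqP => /simpleE.
Qed.
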